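(* Let $\lambda/\mu$ be a connected r-shape, $\tilde{\mathbf a},\tilde{\mathbf b}$ strict flags for it, and $\Theta=(\theta_1,\ldots,\theta_k)$ an outer ribbon decomposition of $\lambda/\mu$. Then $$\mathsf S^{\tilde{\mathbf a},\tilde{\mathbf b}}_{\lambda/\mu}(\mathbf y/\mathbf z)=\det\left[\mathsf S^{\tilde{\mathbf a}^{ij},\tilde{\mathbf b}^{ij}}_{\theta_i\#\theta_j}(\mathbf y/\mathbf z)\right]_{1\le i,j\le k},$$ with entries $1$ when $\theta_i\#\theta_j=\varnothing$ and $0$ when it is undefined.
   Context: Young diagrams in English notation; $\mathrm{row},\mathrm{col}$ of a cell. An r-shape is $(\lambda/\mu,r)$ with shifted contents $c(i,j)=j-i+r-1+\lambda'_1$; connected = edgewise connected. Column flags for an r-shape $\kappa/\nu$: $\mathbf a,\mathbf b\in\mathbb Z^N$, $N\ge\kappa_1$, with $a_i-a_{i+1}\le\nu'_i-\nu'_{i+1}+1$, $b_i-b_{i+1}\le\kappa'_i-\kappa'_{i+1}+1$ whenever $\nu'_i<\kappa'_{i+1}$; conjugates $a'_i=a_i+c(\gamma_i)$, $b'_i=b_i+c(\delta_i)$, $\gamma_i,\delta_i$ top/bottom cells of column $i$. Strict flags: column flags $\tilde{\mathbf a},\tilde{\mathbf b}$ such that moreover $\tilde a_i-\tilde a_{i+1}\le1$ for all $i$. $\mathbf y_{a,b}=(y_a,\ldots,y_b)$ (empty if $a>b$); $e_n(\mathbf x/\mathbf w)=\sum_{i=0}^n(-1)^{n-i}e_i(\mathbf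 x)h_{n-i}(\mathbf w)$. $\mathsf S^{\mathbf a,\mathbf b}_{\kappa/\nu}(\mathbf y/\mathbf z)=\det[e_{\kappa'_i-i-\nu'_j+j}(\mathbf y_{a_j,b_i}/\mathbf z_{a'_j,b'_i})]_{1\le i,j\le N}$. Ribbons: edgewise connected skew diagrams with no $2\times2$ block; head = bottom-left, tail = top-right cell. A cell is on the top (right, bottom, left) perimeter if the neighbour above (right, below, left) is not in $\lambda/\mu$. An outer ribbon decomposition partitions the cells into ribbons with heads on the left/bottom perimeter and tails on the top/right perimeter. A cell $\gamma\in\theta_i$ goes up if the cell above is in $\theta_i$ or $\gamma$ is the tail of $\theta_i$ on the top perimeter; goes right if the cell right of it is in $\theta_i$ or $\gamma$ is the tail on the right perimeter; the top-right cell of $\lambda/\mu$ goes up if the cell below it is in its ribbon, right if the cell left of it is. Equal-content cells go in the same direction. The cutting strip is the ribbon with exactly the contents of $\lambda/\mu$, the content-$(c+1)$ cell directly above (right of) the content-$c$ cell when content-$c$ cells go up (right). $\Theta(p,q)$: sub-ribbon with contents in $[p,q]$ (r-shape with root content $p$); $\varnothing$ if $p=q+1$, undefined if $p>q+1$. $\theta_i\#\theta_j=\Theta(c(\delta_i),c(\gamma_j))$, $\delta_i$ head of $\theta_i$, $\gamma_j$ tail of $\theta_j$. Canonical decomposition $\theta_i\#\theta_j=\rho_1\to\cdots\to\rho_K$: maximal vertical strips from left to right; $\delta_r,\gamma_r$ bottom/top cells of $\rho_r$. Induced strict ribbon flags: $\tilde a^{ij}_r=\tilde a_{\mathrm{col}(m_r)}$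 where $m_r$ is the leftmost cell of $\lambda/\mu$ with content $c(\gamma_r)$; $\tilde b^{ij}_r=\tilde b_{\mathrm{col}(M_r)}-\lambda'_{\mathrm{col}(M_r)}+\mathrm{row}(M_r)$ where $M_r$ is the rightmost cell of $\lambda/\mu$ with content $c(\delta_r)$ (rows/columns measured in $\lambda/\mu$). *)

(* Defs.v *)
From HB Require Import structures.
From mathcomp Require Import all_boot all_order all_algebra.
Set Implicit Arguments.
Unset Strict Implicit.
Unset Printing Implicit Defensive.
Import Order.TTheory GRing.Theory Num.Theory.

Definition esym (R : comNzRingType) (s : seq R) (k : nat) : R :=
  (\sum_(I : {set 'I_(size s)} | #|I| == k) \prod_(i in I) s`_i)%R.

Definition hsym (R : comNzRingType) (s : seq R) (k : nat) : R :=
  (\sum_(t : k.-tuple 'I_(size s) |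
          sorted (fun u v : 'I_(size s) => (u <= v)%N) t)
     \prod_(i <- t) s`_i)%R.

Definition esup (R : comNzRingType) (n : int) (x w : seq R) : R :=
  if (n < 0)%R then 0%R else
  let m := absz n in
  (\sum_(i < m.+1) (-1) ^+ (m - i) * esym x i * hsym w (m - i))%R.

Definition yseg (R : Type) (y : int -> R) (a b : int) : seq R :=
  [seq y (a + i%:Z)%R | i <- iota 0 (if (a <= b)%R then (absz (b - a)).+1 else 0)].

(* Young diagrams, English notation, rows/columns 1-indexed.           *)
(* A cell is (row, col).                                               *)

Definition cell := (nat * nat)%type.

Definition rowLen (lam : seq nat) (i : nat) : nat := nth 0 lam i.-1.
Definition colLen (lam : seq nat) (j : nat) : nat := count (fun x => j <= x) lam.

Definition is_partition (lam : seq nat) : bool := sorted geq lam.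

Definition skew_ok (lam mu : seq nat) : Prop :=
  [/\ is_partition lam, is_partition mu & forall i, rowLen mu i <= rowLen lam i].

Definition in_skew (lam mu : seq nat) (x : cell) : bool :=
  (0 < x.1) && (rowLen mu x.1 < x.2 <= rowLen lam x.1).

Definition content (lam : seq nat) (r : int) (x : cell) : int :=
  (x.2%:Z - x.1%:Z + r - 1 + (colLen lam 1)%:Z)%R.

Definition skew_cells (lam mu : seq nat) : seq cell :=
  [seq x <- [seq (i, j) | j <- iota 1 (rowLen lam 1), i <- iota 1 (size lam)]
   | in_skew lam mu x].

Definition adjacent (x y : cell) : bool :=
  ((x.1 == y.1) && ((x.2 == y.2.+1) || (y.2 == x.2.+1))) ||
  ((x.2 == y.2) && ((x.1 == y.1.+1) || (y.1 == x.1.+1))).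

Definition edge_connected (cs : seq cell) : Prop :=
  forall x y, x \in cs -> y \in cs ->
  exists s : seq cell, [/\ path adjacent x s, all (fun u => u \in cs) s & last x s = y].

(* skew diagram (up to translation) = convex set of cells for the
   componentwise order on (row, col) *)
Definition skew_convex (cs : seq cell) : Prop :=
  forall x y z : cell, x \in cs -> z \in cs ->
  x.1 <= y.1 <= z.1 -> x.2 <= y.2 <= z.2 -> y \in cs.

Definition no_2x2 (cs : seq cell) : Prop :=
  forall x : cell, ~~ [&& x \in cs, (x.1, x.2.+1) \in cs,
                          (x.1.+1, x.2) \in cs & (x.1.+1, x.2.+1) \in cs].

Definition is_ribbon (cs : seq cell) : Prop :=
  [/\ cs != [::], edge_connected cs, skew_convex cs & no_2x2 cs].

Definition head_cell (cs : seq cell) : cell :=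
  let rm := \max_(x <- cs) x.1 in
  (rm, \big[minn/ \max_(x <- cs) x.2]_(x <- cs | x.1 == rm) x.2).

Definition tail_cell (cs : seq cell) : cell :=
  let rm := \big[minn/ \max_(x <- cs) x.1]_(x <- cs) x.1 in
  (rm, \max_(x <- cs | x.1 == rm) x.2).

Definition top_perim lam mu (x : cell) := ~~ in_skew lam mu (x.1.-1, x.2).
Definition right_perim lam mu (x : cell) := ~~ in_skew lam mu (x.1, x.2.+1).
Definition bottom_perim lam mu (x : cell) := ~~ in_skew lam mu (x.1.+1, x.2).
Definition left_perim lam mu (x : cell) := ~~ in_skew lam mu (x.1, x.2.-1).

(* A decomposition (theta_1, ..., theta_k) of lam/mu is encoded by a
   labelling of the cells; theta_i = cells of lam/mu with label i. *)
Definition ribbon_of lam mu k (lab : cell -> 'I_k) (i : 'I_k) : seq cell :=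
  [seq x <- skew_cells lam mu | lab x == i].

Definition outer_ribbon_decomp lam mu k (lab : cell -> 'I_k) : Prop :=
  forall i : 'I_k,
    let th := ribbon_of lam mu lab i in
    [/\ is_ribbon th,
        left_perim lam mu (head_cell th) || bottom_perim lam mu (head_cell th) &
        top_perim lam mu (tail_cell th) || right_perim lam mu (tail_cell th)].

Definition same_ribbon lam mu k (lab : cell -> 'I_k) (x y : cell) : bool :=
  in_skew lam mu y && (lab y == lab x).

Definition goes_up lam mu k (lab : cell -> 'I_k) (x : cell) : bool :=
  let th := ribbon_of lam mu lab (lab x) in
  if x == tail_cell (skew_cells lam mu) then same_ribbon lam mu lab x (x.1.+1, x.2)
  else same_ribbon lam mu lab x (x.1.-1, x.2) || ((x == tail_cell th) && top_perim lam mu x).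

Definition goes_right lam mu k (lab : cell -> 'I_k) (x : cell) : bool :=
  let th := ribbon_of lam mu lab (lab x) in
  if x == tail_cell (skew_cells lam mu) then same_ribbon lam mu lab x (x.1, x.2.-1)
  else same_ribbon lam mu lab x (x.1, x.2.+1) || ((x == tail_cell th) && right_perim lam mu x).

(* direction of content c in the cutting strip: true = up, false = right *)
Definition dir_up lam mu (r : int) k (lab : cell -> 'I_k) (c : int) : bool :=
  has (fun x => (content lam r x == c) && goes_up lam mu lab x) (skew_cells lam mu).

(* The sub-ribbon Theta(p,q) of the cutting strip, as an r-shape with  *)
(* root content p. u = direction map, L = q - p + 1 = number of cells; *)
(* the cell of offset t (content p + t) has row rib_row t, col rib_col t *)

Definition nups (u : int -> bool) (p : int) (t : nat) : nat :=
  \sum_(s < t) (u (p + s%:Z)%R : nat).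
Definition rib_rows u p L := (nups u p L.-1).+1.
Definition rib_cols u p L := (L.-1 - nups u p L.-1).+1.
Definition rib_row u p L t := rib_rows u p L - nups u p t.
Definition rib_col u p t := (t - nups u p t).+1.

Definition rib_lam u p L : seq nat :=
  mkseq (fun i => \max_(t < L | rib_row u p L t == i.+1) rib_col u p t) (rib_rows u p L).
Definition rib_mu u p L : seq nat :=
  mkseq (fun i => (\big[minn/rib_cols u p L]_(t < L | rib_row u p L t == i.+1)
                      rib_col u p t).-1) (rib_rows u p L).

Definition rib_top_off u p L rc := \max_(t < L | rib_col u p t == rc) t.
Definition rib_bot_off u p L rc := \big[minn/L]_(t < L | rib_col u p t == rc) t.

Definition leftmost_cell lam mu r (c : int) : cell :=
  head (0, 0) [seq x <- skew_cells lam mu | content lam r x == c].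
Definition rightmost_cell lam mu r (c : int) : cell :=
  last (0, 0) [seq x <- skew_cells lam mu | content lam r x == c].

Definition ind_a lam mu r (af : seq int) u p L : seq int :=
  mkseq (fun r0 =>
    let m := leftmost_cell lam mu r (p + (rib_top_off u p L r0.+1)%:Z)%R in
    nth 0%R af m.2.-1) (rib_cols u p L).
Definition ind_b lam mu r (bf : seq int) u p L : seq int :=
  mkseq (fun r0 =>
    let M := rightmost_cell lam mu r (p + (rib_bot_off u p L r0.+1)%:Z)%R in
    (nth 0%R bf M.2.-1 - (colLen lam M.2)%:Z + M.1%:Z)%R) (rib_cols u p L).

Definition fl (a : seq int) (i : nat) : int := nth 0%R a i.-1.

Definition column_flags lam mu (a b : seq int) : Prop :=
  [/\ size b = size a, rowLen lam 1 <= size a &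
      forall i, 0 < i < size a -> colLen mu i < colLen lam i.+1 ->
        (fl a i - fl a i.+1 <= (colLen mu i)%:Z - (colLen mu i.+1)%:Z + 1)%R /\
        (fl b i - fl b i.+1 <= (colLen lam i)%:Z - (colLen lam i.+1)%:Z + 1)%R].

Definition strict_flags lam mu (a b : seq int) : Prop :=
  column_flags lam mu a b /\
  forall i, 0 < i < size a -> (fl a i - fl a i.+1 <= 1)%R.

Definition Sdet (R : comNzRingType) lam mu (r : int) (a b : seq int) (y z : int -> R) : R :=
  \det (\matrix_(i < size a, j < size a)
    let i1 := i.+1 in let j1 := j.+1 in
    let a' := (fl a j1 + content lam r ((colLen mu j1).+1, j1))%R in
    let b' := (fl b i1 + content lam r (colLen lam i1, i1))%R in
    esup ((colLen lam i1)%:Z - i1%:Z - (colLen mu j1)%:Z + j1%:Z)%R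
         (yseg y (fl a j1) (fl b i1)) (yseg z a' b')).

(* the (i,j) entry S^{a^{ij},b^{ij}}_{theta_i # theta_j}(y/z), with the
   conventions 1 if theta_i#theta_j is empty and 0 if it is undefined *)
Definition hash_entry (R : comNzRingType) lam mu (r : int) k (lab : cell -> 'I_k)
    (af bf : seq int) (y z : int -> R) (i j : 'I_k) : R :=
  let p := content lam r (head_cell (ribbon_of lam mu lab i)) in
  let q := content lam r (tail_cell (ribbon_of lam mu lab j)) in
  if p == (q + 1)%R then 1%R
  else if (q + 1 < p)%R then 0%R
  else
    let L := absz (q - p + 1)%R in
    let u := dir_up lam mu r lab in
    Sdet (rib_lam u p L) (rib_mu u p L) p
         (ind_a lam mu r af u p L) (ind_b lam mu r bf u p L) y z.

(* Main.v *)
Require Import Defs.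
From HB Require Import structures.
From mathcomp Require Import all_boot all_order all_algebra.
From mathcomp Require Import perm zify ring.
Set Implicit Arguments.
Unset Strict Implicit.
Unset Printing Implicit Defensive.
Import Order.TTheory GRing.Theory Num.Theory.

(* The flagged entries depend on a pair of contents only: a column with bottom
   content c and top content d - 1 contributes T(c, d), where T is unit upper
   triangular, and both sides are expressions in minors of T.  Let X be the set
   of contents c such that the cutting strip steps right from c - 1 to c.  The
   sub-ribbon Theta(p, w - 1) is the minor P(p, w) of T with rows
   {p} + X & (p, w) and columns X & (p, w) + {w}, and up to signs P = U V^-1,
   where the rows of U (resp. V) indexed by X (resp. by its complement) are unit
   vectors and the other rows are those of T.  Hence det P(p_i, w_j) is the
   determinant of V with row w_i replaced by row p_i of U.  The left-hand side is
   the same construction for X empty, with the columns of the shape as ribbons.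
   The two row systems agree up to order; sweeping over the contents and keeping
   the list of ribbons (resp. columns) that meet the current diagonal shows that
   the sign of the permutation is the product of the signs relating P and U V^-1. *)

(** * Determinants *)

(** Expanding a ribbon minor along its last column gives a recursion in [w]: a final merged column
    from [t] up to [w] splits off as a factor [T t w]. Read as a matrix identity, the recursion says
    [P V = U] up to signs, which is where the two mixed matrices come from. Row [p] of [U] is taken
    to be a unit vector for [p] in [X], because the term [t = p] is then already supplied by row [p]
    of [V]. The shape itself fits the same [T] because the top cell of a column is the leftmost cell
    of its diagonal and the bottom cell the rightmost one, so the flags induced at these contents
    are the flags of the column. The permutation between the two row systems is never written down.
    The waiting rows are kept in the column order of the current diagonal. A diagonal is an interval
    of columns whose ends move by at most one, so ribbons enter and leave only at the ends of the
    list, and each position costs only a few row moves. The resulting sign counts the pairs of a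
    ribbon and an element of [X] among its contents, and so does the product of the signs in [P]. *)

Section Algebra.
Local Open Scope ring_scope.
Variable R : comNzRingType.

(** The two block products have the same factors in opposite orders, and the factor that contains
    only [B] is unitriangular; both determinants therefore equal that of the other factor. *)
Lemma det_1_mulmxC m n (A : 'M[R]_(m, n)) (B : 'M[R]_(n, m)) :
  \det (1%:M + A *m B) = \det (1%:M + B *m A).
Proof.
have e1 : block_mx 1%:M A (- B) 1%:M *m block_mx 1%:M 0 B 1%:M
    = block_mx (1%:M + A *m B) A 0 (1%:M : 'M[R]_n).
  by rewrite mulmx_block !mul1mx !mulmx1 !mulmx0 ?mul0mx !add0r addNr.
have e2 : block_mx 1%:M 0 B 1%:M *m block_mx 1%:M A (- B) 1%:M
    = block_mx 1%:M A 0 (1%:M + B *m A : 'M[R]_n).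
  by rewrite mulmx_block !mul1mx !mulmx1 !mul0mx !addr0 subrr addrC.
have := congr1 determinant e1; have := congr1 determinant e2.
by rewrite !det_mulmx !det_lblock !det_ublock !det1 !mulr1 !mul1r => -> ->.
Qed.

(* With S the selection of the rows w_i, the matrix with replaced rows is
   V + S^T (U_p - S V); dividing by V on the right and exchanging the two
   factors collapses it to the minor of M = U V^-1. *)
Lemma det_replace_rows n k (M U V : 'M[R]_n) (p w : 'I_k -> 'I_n) :
  M *m V = U -> \det V = 1 -> injective w ->
  \det (\matrix_(i, j) M (p i) (w j)) =
  \det (\matrix_x (if [pick i | w i == x] is Some i then row (p i) U else row x V)).
Proof.
move=> MV dV injw.
pose S : 'M[R]_(k, n) := \matrix_(i, x) (w i == x)%:R.
have SS : S *m S^T = 1%:M.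
  apply/matrixP => i j; rewrite !mxE (bigD1 (w i)) //= !mxE eqxx mul1r big1.
    by rewrite addr0 (inj_eq injw) eq_sym.
  by move=> x xw; rewrite !mxE eq_sym (negbTE xw) mul0r.
pose PM : 'M[R]_(k, n) := \matrix_i row (p i) M.
have -> : \matrix_(i, j) M (p i) (w j) = 1%:M + (PM - S) *m S^T.
  rewrite mulmxBl SS addrCA subrr addr0; apply/matrixP => i j.
  rewrite [RHS]mxE (bigD1 (w j)) //= !mxE eqxx mulr1 [X in _ + X]big1 ?addr0 //.
  by move=> x xw; rewrite !mxE eq_sym (negbTE xw) mulr0.
rewrite -det_1_mulmxC -[LHS]mulr1 -{2}dV -det_mulmx; congr (\det _).
rewrite mulmxDl mul1mx -mulmxA mulmxBl.
have -> : PM *m V = \matrix_i row (p i) U.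
  by apply/row_matrixP => i; rewrite row_mul !rowK -row_mul MV.
have -> : S *m V = \matrix_i row (w i) V.
  apply/matrixP => i j; rewrite mxE (bigD1 (w i)) //= !mxE eqxx mul1r big1 ?addr0 //.
  by move=> x xw; rewrite !mxE eq_sym (negbTE xw) mul0r.
apply/row_matrixP => x; rewrite rowK; apply/rowP => j; rewrite !mxE.
case: pickP => [i /eqP wi | now].
  rewrite (bigD1 i) //= !mxE wi eqxx mul1r big1 ?addr0; first by rewrite addrC subrK.
  by move=> l li; rewrite !mxE -wi (inj_eq injw) (negbTE li) mul0r.
rewrite big1 ?addr0 ?mxE // => i _.
by rewrite !mxE now mul0r.
Qed.

(** A list of rows can be cut and spliced during the sweep; the size hypotheses of the lemmas that
    follow keep the default row [0] from being read. *)
Definition det_rows n (s : seq 'rV[R]_n) : R := \det (\matrix_(i < n) nth 0 s i).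

Lemma det_rows_swap n (s1 s2 : seq 'rV[R]_n) u v :
  size (s1 ++ u :: v :: s2) = n ->
  det_rows (s1 ++ u :: v :: s2) = - det_rows (s1 ++ v :: u :: s2).
Proof.
move=> sz; have lt2 : ((size s1).+1 < n)%N by move: sz; rewrite size_cat /=; lia.
have lt1 : (size s1 < n)%N by exact: ltnW.
pose i1 := Ordinal lt1; pose i2 := Ordinal lt2.
rewrite /det_rows; set A := (X in \det X = _); set B := (X in - \det X).
have -> : A = row_perm (tperm i1 i2) B.
  apply/matrixP => i j; rewrite !mxE.
  case: tpermP => [->|->|] /=.
  - by rewrite !nth_cat ltnn subnn ltnNge leqnSn /= subSn // subnn.
  - by rewrite !nth_cat ltnn subnn ltnNge leqnSn /= subSn // subnn.
  move=> /eqP ne1 /eqP ne2; rewrite !nth_cat.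
  case: ltnP => // le; have {}ne1 : (i != size s1 :> nat) by [].
  have {}ne2 : (i != (size s1).+1 :> nat) by [].
  by have -> : (i - size s1 = (i - size s1 - 2).+2)%N by lia.
rewrite row_permE det_mulmx det_perm odd_tperm.
have -> : i1 != i2 by rewrite -(inj_eq val_inj) /= neq_ltn ltnSn.
by rewrite expr1 mulN1r.
Qed.

Lemma det_rows_move n (s1 s2 s3 : seq 'rV[R]_n) v :
  size (s1 ++ v :: s2 ++ s3) = n ->
  det_rows (s1 ++ v :: s2 ++ s3) =
  (-1) ^+ size s2 * det_rows (s1 ++ s2 ++ v :: s3).
Proof.
elim: s2 s1 => [|u s2 IH] s1 /= sz; first by rewrite mul1r.
rewrite det_rows_swap // -cat_rcons IH; last first.
  by move: sz; rewrite !(size_cat, size_rcons) /= size_cat; lia.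
by rewrite cat_rcons exprS mulN1r mulNr.
Qed.

End Algebra.

(** * Comparing two orders of the same rows by a sweep over the positions *)

Section Sweep.
Local Open Scope ring_scope.
Variables (R : comNzRingType) (n : nat).
Variables (X col_ends col_starts : pred nat) (e T g h : nat -> 'rV[R]_n).
Variables (A B : nat -> seq 'rV[R]_n).

(* C x lists the rows still waiting for a position before position x is filled
   by the row f x.  In an up step the first of them is used if a column ends at x;
   in a right step the last one is used if no column starts at x. *)
Definition up_step (f : nat -> 'rV[R]_n) (C : nat -> seq 'rV[R]_n) x :=
  f x :: C x.+1 =
  (if col_ends x then C x else e x :: C x) ++ (if col_starts x then [:: T x] else [::]).

Definition right_step (f : nat -> 'rV[R]_n) (C : nat -> seq 'rV[R]_n) x :=
  exists2 M, C x = if col_starts x then M else rcons M (f x) &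
  (col_starts x -> f x = T x) /\ C x.+1 = (if col_ends x then [::] else [:: e x]) ++ M.

Lemma size_up_step f C x : up_step f C x ->
  ((size (C x.+1)).+1 = size (C x) + ~~ col_ends x + col_starts x)%N.
Proof.
move=> /(congr1 size); rewrite /= size_cat => ->.
by case: (col_ends x); case: (col_starts x); rewrite /= ?addn0 ?addn1.
Qed.

Lemma size_right_step f C x : right_step f C x ->
  ((size (C x.+1)).+1 = size (C x) + ~~ col_ends x + col_starts x)%N.
Proof.
move=> [M -> [_ ->]]; rewrite size_cat.
by case: (col_ends x); case: (col_starts x); rewrite /= ?size_rcons ?addn0 ?addn1.
Qed.

(** Up steps reorder both systems in the same way, so only right steps cost a sign: there the row
    [g x] has to pass from the front of [A x.+1] to its back. *)
Lemma det_rows_sweep :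
  A 0%N = [::] -> B 0%N = [::] ->
  (forall x, (x < n)%N -> up_step h B x) ->
  (forall x, (x < n)%N -> if X x then right_step g A x else up_step g A x) ->
  A n = [::] ->
  det_rows (mkseq g n) =
  (-1) ^+ (\sum_(x < n | X x) size (A x.+1)) * det_rows (mkseq h n).
Proof.
move=> A0 B0 stepB stepA An.
(* Both kinds of step change the length by the same amount, so the two lists stay equally long
   although their entries differ. *)
have szAB x : (x <= n)%N -> size (A x) = size (B x).
  elim: x => [|x IH] ltx; first by rewrite A0 B0.
  have := stepA x ltx; have /size_up_step := stepB x ltx; rewrite -(IH (ltnW ltx)).
  by case: (X x) => [sb /size_right_step | sb /size_up_step]; rewrite -sb => -[].
(* [S] holds the rows that enter at position [x] or later. At [x = 0] both sides are the determinant
   of [S] alone; at [x = n] the list [S] is empty. *)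
have main x : (x <= n)%N -> forall S, (x + size (A x) + size S = n)%N ->
    det_rows (mkseq g x ++ A x ++ S) =
    (-1) ^+ (\sum_(y < x | X y) size (A y.+1)) * det_rows (mkseq h x ++ B x ++ S).
  elim: x => [|x IH] ltx S sz; first by rewrite big_ord0 mul1r A0 B0.
  have {}IH := IH (ltnW ltx).
  have szx : size (A x) = size (B x) by apply: szAB; exact: ltnW.
  (* Undoing an up step returns the entering rows to the front of [S]. The only cost is to carry
     [e x] across the waiting list when no column ends, and this cost depends on the length
     alone. *)
  have up f C : size (C x) = size (A x) -> size (C x.+1) = size (A x.+1) ->
      up_step f C x ->
      det_rows (mkseq f x.+1 ++ C x.+1 ++ S) = (-1) ^+ (~~ col_ends x * size (A x)) *
      det_rows (mkseq f x ++ C x ++ nseq (~~ col_ends x) (e x) ++ nseq (col_starts x) (T x) ++ S).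
    move=> szC szC' st; have szs := size_up_step st.
    rewrite mkseqS cat_rcons -cat_cons st -szC.
    have -> : (if col_starts x then [:: T x] else [::]) = nseq (col_starts x) (T x).
      by case: (col_starts x).
    rewrite -catA; case: ifP => col_ends_x /=; first by rewrite mul0n mul1r.
    rewrite det_rows_move ?mul1n // !size_cat /= !size_cat size_mkseq size_nseq.
    by move: szs; rewrite col_ends_x /=; lia.
  have hB := up h B (esym szx) (esym (szAB _ ltx)) (stepB x ltx).
  have -> : (\sum_(y < x.+1 | X y) size (A y.+1) =
      \sum_(y < x | X y) size (A y.+1) + (if X x then size (A x.+1) else 0))%N.
    by rewrite big_mkcond big_ord_recr -big_mkcond.
  set E := (\sum_(i < x | _) _)%N in IH *.
  move: (stepA x ltx).
  case Xx: (X x) => stA; last first.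
    rewrite addn0 hB (up _ _ _ _ stA) // IH; first by rewrite mulrCA.
    have := size_up_step stA; rewrite !size_cat !size_nseq; lia.
  have szs := size_right_step stA; rewrite hB.
  case: stA => M AM [gT AS].
  move: IH szs sz; rewrite {up hB} AS szx mkseqS cat_rcons.
  (* In all four cases, moving [g x] behind [A x.+1] gives the new sign. What remains differs from
     the state at [x] by carrying [e x] across the list when no column ends, which the [h] side has
     to do as well. *)
  case col_starts_x: (col_starts x) AM gT => AM gT; case col_ends_x: (col_ends x);
    rewrite /= AM /= ?mul1n ?mul0n.
  - rewrite gT // => IH szs sz; rewrite det_rows_move.
      by rewrite IH /= ?exprD; [ring | lia].
    rewrite size_cat /= size_cat size_mkseq; lia.
  - rewrite gT // => IH szs sz.
    rewrite -[X in mkseq g x ++ X]/(T x :: (e x :: M) ++ S) det_rows_move /=; last first.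
      rewrite size_cat /= size_cat size_mkseq; lia.
    rewrite det_rows_move ?IH; first last.
    + rewrite size_cat /= size_cat /= size_mkseq; lia.
    + rewrite /=; lia.
    have szB : size (B x) = size M by rewrite -szx AM.
    rewrite /= szB exprD exprS.
    have -> : mkseq h x ++ B x ++ [:: e x, T x & S] = (mkseq h x ++ B x) ++ [:: e x, T x & S].
      by rewrite catA.
    rewrite det_rows_swap; first by rewrite -!catA; ring.
    rewrite !size_cat size_mkseq /=; lia.
  - move=> IH szs sz; rewrite det_rows_move; last first.
      rewrite size_cat /= size_cat size_mkseq; lia.
    rewrite -cat_rcons IH; last by rewrite /=; lia.
    by rewrite exprD; ring.
  move=> IH szs sz.
  rewrite -[X in mkseq g x ++ X]/(g x :: (e x :: M) ++ S) det_rows_move /=; last first.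
    rewrite size_cat /= size_cat size_mkseq; lia.
  rewrite det_rows_move; last first.
    rewrite size_cat /= size_cat /= size_mkseq; lia.
  have -> : mkseq g x ++ M ++ [:: e x, g x & S] = (mkseq g x ++ M) ++ [:: e x, g x & S].
    by rewrite catA.
  rewrite det_rows_swap; last by rewrite !size_cat size_mkseq /=; lia.
  have -> : (mkseq g x ++ M) ++ [:: g x, e x & S] = mkseq g x ++ rcons M (g x) ++ e x :: S.
    by rewrite cat_rcons -catA.
  rewrite IH; last by rewrite /=; lia.
  have -> : size (B x) = (size M).+1 by lia.
  by rewrite exprD !exprS; ring.
have Bn : B n = [::] by apply: size0nil; rewrite -szAB ?An.
by have := main n (leqnn n) [::]; rewrite An Bn !cats0 !addn0 => -> .
Qed.
End Sweep.

(** * Ribbon minors as entries of a quotient of two unitriangular matrices *)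

Section RibbonMinors.
Local Open Scope ring_scope.
Variables (R : comNzRingType) (X : pred nat) (T : nat -> nat -> R).
Hypothesis T1 : forall x, T x x = 1.
Hypothesis T0 : forall x y, (y < x)%N -> T x y = 0.

Definition Umx n : 'M[R]_n :=
  \matrix_(x, y) if X x then (x == y)%:R else T x y.
Definition Vmx n : 'M[R]_n :=
  \matrix_(x, y) if X x then T x y else (x == y)%:R.
(** A product of two such signs counts the elements of [X] between the two positions, so a sign that
    depends on an interval becomes a row factor times a column factor. *)
Definition xsign t : R := (-1) ^+ count X (iota 0 t).

Lemma det_Vmx n : \det (Vmx n) = 1.
Proof.
rewrite -det_tr det_trig.
  by apply: big1 => i _; rewrite !mxE eqxx T1; case: ifP.
apply/is_trig_mxP => i j lij; rewrite !mxE T0 //.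
by case: eqP lij => [->|]; rewrite ?ltnn //; case: ifP.
Qed.

(** As [Vmx n] has determinant 1, its adjugate is its inverse over any commutative ring. *)
Definition ribQ n : 'M[R]_n :=
  \matrix_(p, w) (xsign p * xsign w * (Umx n *m \adj (Vmx n)) p w).

Lemma xsign_mul t w : (t <= w)%N -> xsign t * xsign w = (-1) ^+ count X (iota t (w - t)).
Proof.
move=> tw; have -> : xsign w = (-1) ^+ count X (iota 0 t ++ iota t (w - t)).
  by rewrite -[t in iota t]add0n -iotaD subnKC.
rewrite count_cat exprD mulrA -expr2.
by rewrite sqrr_sign mul1r.
Qed.

Lemma xsign_sq t : xsign t * xsign t = 1.
Proof. by rewrite -expr2 sqrr_sign. Qed.

Lemma xsign_mulK p t q : xsign p * xsign t * (xsign p * xsign t * q) = q.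
Proof.
have -> : xsign p * xsign t * (xsign p * xsign t * q) = (xsign p * xsign p) * (xsign t * xsign t) * q.
  by ring.
by rewrite !xsign_sq !mul1r.
Qed.

Lemma mulmx_ribQ n (p w : 'I_n) :
  \sum_(t < n) xsign p * xsign t * ribQ n p t * Vmx n t w = Umx n p w.
Proof.
have : (Umx n *m \adj (Vmx n)) *m Vmx n = Umx n.
  by rewrite -mulmxA mul_adj_mx det_Vmx mulmx1.
move=> /matrixP/(_ p w) <-; rewrite [RHS]mxE; apply: eq_bigr => t _.
by rewrite [ribQ _ _ _]mxE xsign_mulK.
Qed.

(** This is column [w] of the identity [Q V = U], solved for the term [t = w], where [V] has entry
    1. The other rows of [V] outside [X] are unit vectors and vanish in this column; the rows in [X]
    vanish beyond [w] by triangularity. *)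
Lemma ribQ_rec0 n (p w : 'I_n) :
  ribQ n p w = xsign p * xsign w * Umx n p w -
     \sum_(t < n | X t && (t < w)%N) xsign t * xsign w * ribQ n p t * T t w.
Proof.
rewrite -mulmx_ribQ (bigD1 w) //= mulrDr.
have -> : Vmx n w w = 1 by rewrite mxE T1 eqxx; case: ifP.
rewrite mulr1 xsign_mulK.
have -> : \sum_(i < n | i != w) xsign p * xsign i * ribQ n p i * Vmx n i w =
    \sum_(i < n | X i && (i < w)%N) xsign p * xsign i * ribQ n p i * T i w.
  rewrite (bigID (fun t : 'I_n => X t && (t < w)%N)) /= [X in _ + X]big1 ?addr0.
    apply: eq_big => [i|i /andP[_ /andP[Xi _]]]; last by rewrite [Vmx _ _ _]mxE Xi.
    by rewrite -(inj_eq val_inj) /=; case: ltngtP => //=; rewrite ?andbF.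
  move=> t /andP[tw]; rewrite negb_and [Vmx _ _ _]mxE => /orP[/negbTE->|].
    by rewrite (negbTE tw) mulr0.
  rewrite -leqNgt leq_eqVlt eq_sym (inj_eq val_inj) (negbTE tw) /= => lt.
  by rewrite T0 //; case: ifP; rewrite mulr0.
rewrite mulr_sumr -addrA -sumrB big1 ?addr0 // => t _.
have -> : xsign p * xsign w * (xsign p * xsign t * ribQ n p t * T t w) =
  (xsign p * xsign p) * (xsign t * xsign w * ribQ n p t * T t w) by ring.
by rewrite xsign_sq mul1r subrr.
Qed.

Lemma ribQ_lt n (p w : 'I_n) : (w < p)%N -> ribQ n p w = 0.
Proof.
have [m] := ubnP (w : nat); elim: m => // m IH in w *; rewrite ltnS => wm wp.
rewrite ribQ_rec0 big1 ?subr0 => [|t /andP[_ tw]].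
  by rewrite mxE T0 // -(inj_eq val_inj) gtn_eqF //; case: ifP; rewrite mulr0.
rewrite IH ?mulr0 ?mul0r //; first exact: leq_trans tw wm.
exact: ltn_trans tw wp.
Qed.

Lemma ribQ_diag n (p : 'I_n) : ribQ n p p = 1.
Proof.
rewrite ribQ_rec0 xsign_sq mul1r big1 ?subr0 => [|t /andP[_ tp]].
  by rewrite mxE T1 eqxx; case: ifP.
by rewrite ribQ_lt ?mulr0 ?mul0r.
Qed.

(** The term [t = p] has two origins: if [p] is in [X] it belongs to the sum and the entry of [U] is
    0; otherwise it is the entry [T p w] of [U]. For [t] in [X] the minus sign in front of the sum
    cancels the contribution of [t] itself to the sign, leaving the elements of [X] strictly between
    [t] and [w]. *)
Lemma ribQ_rec n (p w : 'I_n) : (p < w)%N ->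
  ribQ n p w = \sum_(t < n | ((t == p) || X t) && (p <= t < w)%N)
    (-1) ^+ count X (iota t.+1 (w - t.+1)) * (T t w * ribQ n p t).
Proof.
move=> pw; rewrite ribQ_rec0.
have -> : \sum_(t < n | X t && (t < w)%N) xsign t * xsign w * ribQ n p t * T t w =
    \sum_(t < n | X t && (t < w)%N && (p <= t)%N) xsign t * xsign w * ribQ n p t * T t w.
  rewrite [RHS]big_mkcondr; apply: eq_bigr => t _; case: leqP => // tp.
  by rewrite ribQ_lt ?mulr0 ?mul0r.
rewrite -sumrN [RHS](bigD1 p) /=; last by rewrite eqxx leqnn.
have step (t : 'I_n) : (t < w)%N -> xsign t * xsign w =
    (-1) ^+ X t * (-1) ^+ count X (iota t.+1 (w - t.+1)).
  move=> tw.
  rewrite xsign_mul; last exact: ltnW.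
  have -> : (w - t = (w - t.+1).+1)%N by rewrite subnSK.
  by rewrite /= exprD.
have sumE (P : pred 'I_n) : (forall t, P t -> X t && (t < w)%N) ->
    \sum_(t | P t) - (xsign t * xsign w * ribQ n p t * T t w) =
    \sum_(t | P t) (-1) ^+ count X (iota t.+1 (w - t.+1)) * (T t w * ribQ n p t).
  by move=> PX; apply: eq_bigr => t /PX /andP[Xt tw]; rewrite step // Xt; ring.
case Xp: (X p).
  rewrite (bigD1 p) /= ?Xp ?pw ?leqnn // mxE Xp -(inj_eq val_inj) ltn_eqF //.
  rewrite mulr0 add0r ribQ_diag step // Xp sumE; last by move=> t /andP[/andP[->]].
  congr (_ + _); first by ring.
  apply: eq_bigl => t; case: eqP => //=; rewrite ?andbF // andbT => _.
  by rewrite andbT -andbA; congr (_ && _); rewrite andbC.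
rewrite mxE Xp step // Xp mul1r ribQ_diag mulr1; congr (_ + _).
rewrite sumE; last by move=> t /andP[].
apply: eq_bigl => t; case: eqP => [->|_] /=; first by rewrite Xp andbF.
by rewrite andbT -andbA; congr (_ && _); rewrite andbC.
Qed.

Lemma det_mx_ublock k l (f : nat -> nat -> R) :
  (forall a b, (k <= a < k + l)%N -> (b < k)%N -> f a b = 0) ->
  \det (\matrix_(i < k + l, j < k + l) f i j) =
  \det (\matrix_(i < k, j < k) f i j) *
  \det (\matrix_(i < l, j < l) f (k + i)%N (k + j)%N).
Proof.
move=> f0; set A := (X in \det X = _); rewrite -(submxK A).
have -> : dlsubmx A = 0.
  by apply/matrixP => i j; rewrite !mxE f0 //= leq_addr ltn_add2l ltn_ord.
by rewrite det_ublock; congr (_ * _); congr (\det _); apply/matrixP => i j; rewrite !mxE.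
Qed.

Lemma det_mx_unitrig l (f : nat -> nat -> R) :
  (forall a, (a < l)%N -> f a a = 1) ->
  (forall a b, (b < a < l)%N -> f a b = 0) ->
  \det (\matrix_(i < l, j < l) f i j) = 1.
Proof.
move=> f1 f0; rewrite -det_tr det_trig.
  by apply: big1 => i _; rewrite !mxE f1.
by apply/is_trig_mxP => i j lij; rewrite !mxE f0 // lij ltn_ord.
Qed.

(** The subdiagonal entries are [T (r i) (r i) = 1] and everything below them vanishes. Deleting row
    [m] and the last column thus leaves a block triangular matrix: the leading [m] by [m] minor, and
    a trailing block whose diagonal is the old subdiagonal of ones. *)
Lemma det_hessenberg n (r : nat -> nat) :
  {homo r : i j / (i < j)%N} ->
  \det (\matrix_(i < n.+1, j < n.+1) T (r i) (r j.+1)) =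
  \sum_(m < n.+1) (-1) ^+ (n - m) * (T (r m) (r n.+1) *
    \det (\matrix_(i < m, j < m) T (r i) (r j.+1))).
Proof.
move=> r_inc; rewrite (expand_det_col _ ord_max); apply: eq_bigr => m _.
rewrite !mxE /= /cofactor /=.
have mn : (m <= n)%N by rewrite -ltnS.
have -> : (-1) ^+ (m + n) = (-1) ^+ (n - m) :> R.
  by rewrite -signr_odd -[RHS]signr_odd oddB // oddD addbC.
rewrite mulrCA; congr (_ * (_ * _)); pose f a b := T (r (bump m a)) (r b.+1).
have -> : row' m (col' ord_max (\matrix_(i < n.+1, j < n.+1) T (r i) (r j.+1))) =
    \matrix_(i < n, j < n) f i j.
  apply/matrixP => i j; rewrite !mxE /f /= /bump.
  by rewrite [(n <= j)%N]leqNgt ltn_ord.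
have -> : \det (\matrix_(i < n, j < n) f i j) =
    \det (\matrix_(i < m + (n - m), j < m + (n - m)) f i j) by rewrite subnKC.
rewrite det_mx_ublock; last first.
  move=> a b /andP[ma _] bm; rewrite /f /bump ma T0 // r_inc //.
  by rewrite add1n ltnS (leq_trans bm ma).
rewrite (@det_mx_unitrig (n - m) (fun a b => f (m + a)%N (m + b)%N)); first last.
- move=> a b /andP[ba _]; rewrite /f /bump leq_addr T0 // r_inc //.
  by rewrite add1n !ltnS ltn_add2l.
- by move=> a _; rewrite /f /bump leq_addr add1n T1.
rewrite mulr1; congr (\det _); apply/matrixP => i j; rewrite !mxE /f /bump.
by rewrite [(m <= i)%N]leqNgt ltn_ord.
Qed.

(* r enumerates p followed by the elements of X beyond p. *)
Lemma det_ribQ n m (r : nat -> nat) (p w : 'I_n) :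
  {homo r : i j / (i < j)%N} -> r 0%N = p -> r m = w ->
  (forall i, (0 < i < m)%N -> X (r i)) ->
  (forall x, (p < x < w)%N -> X x -> exists2 i, (0 < i < m)%N & r i = x) ->
  \det (\matrix_(i < m, j < m) T (r i) (r j.+1)) = ribQ n p w.
Proof.
move=> r_inc r0; have [b] := ubnP m; elim: b => // b IH in m w *.
rewrite ltnS => mb rm rX Xr.
have r_leq := leq_mono r_inc; have r_mono := leqW_mono r_leq; have r_inj := incn_inj r_leq.
case: m => [|m] in mb rm rX Xr *.
  have -> : w = p by apply: val_inj; rewrite /= -rm -r0.
  by rewrite det_mx00 ribQ_diag.
have pw : (p < w)%N by rewrite -r0 -rm r_mono.
(* Both sides are now sums over the start of the merged last column; [rr] matches row indices with
   the positions [t] of the recursion. *)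
rewrite det_hessenberg // ribQ_rec //.
have rlt (i : 'I_m.+1) : (r i < n)%N by apply: leq_trans (ltn_ord w); rewrite -rm ltnS ltnW // r_mono.
pose rr i := Ordinal (rlt i).
have memr x : (p <= x < w)%N -> (x == p) || X x -> exists2 i : 'I_m.+1, x = r i & true.
  move=> /andP[]; rewrite leq_eqVlt => /predU1P[<- _ _|px xw].
    by exists ord0; rewrite //= r0.
  rewrite gtn_eqF //= => /(Xr x) []; first by rewrite px xw.
  by move=> i /andP[_ im] <-; exists (Ordinal im).
rewrite -[RHS]big_filter [RHS](perm_big [seq rr i | i <- enum 'I_m.+1]); last first.
  apply: uniq_perm.
  - by apply: filter_uniq; exact: index_enum_uniq.
  - rewrite map_inj_uniq ?enum_uniq // => i j /(congr1 val) /= ij.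
    by apply: val_inj; exact: r_inj ij.
  move=> t; rewrite mem_filter mem_index_enum andbT; apply/idP/mapP.
    move=> /andP[tX tpw]; have [|i ti _] := memr t tpw.
      by case/orP: tX => [/eqP->|->]; rewrite ?eqxx ?orbT.
    by exists i; rewrite ?mem_enum //; apply: val_inj.
  case=> i _ ->; have := ltn_ord i; rewrite /= -r0 -rm r_mono r_leq => -> /=.
  rewrite andbT.
  case: (posnP i) => [i0|i0].
    by rewrite -(inj_eq val_inj) /= i0 r0 eqxx.
  by rewrite rX ?orbT ?i0 ?ltn_ord.
rewrite big_map enumT; apply: eq_bigr => i _; congr (_ * (_ * _)).
(* The exponent [m - i] counts [r i.+1], ..., [r m], and these are the elements of [X] strictly
   between [r i] and [w]. *)
- have -> : w = r m.+1 :> nat by [].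
  congr (_ ^+ _); rewrite -[LHS](size_iota 0) -size_filter -(size_map (fun l => r (i.+1 + l)%N)).
  have eqn : [seq r (i.+1 + l)%N | l <- iota 0 (m - i)] =i
      [seq x <- iota (rr i).+1 (r m.+1 - (rr i).+1) | X x].
    move=> x; rewrite mem_filter mem_iota /=; apply/mapP/andP.
      case=> l; rewrite mem_iota add0n /= => lm ->; split.
        by rewrite rX //; move: lm (ltn_ord i); lia.
      rewrite r_mono addSn ltnS leq_addr /= subnKC; first by rewrite r_mono; lia.
      by rewrite r_mono ltn_ord.
    case=> Xx; rewrite subnKC ?r_mono ?ltn_ord // => /andP[ix xm].
    have [|j jm jx] := Xr x _ Xx.
      by rewrite -rm xm andbT (leq_ltn_trans _ ix) // -r0 r_leq.
    exists (j - i.+1)%N; last by rewrite subnKC // -r_mono jx.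
    by rewrite mem_iota add0n leq0n; move: jm ix; rewrite -jx r_mono; lia.
  apply: perm_size; apply: uniq_perm => //; last by rewrite filter_uniq ?iota_uniq.
  rewrite map_inj_uniq ?iota_uniq // => l1 l2 e12.
  by apply/eqP; rewrite -(eqn_add2l i.+1); apply/eqP/r_inj.
- by rewrite rm.
have im := ltn_ord i; apply: IH => //.
- exact: leq_trans im mb.
- by move=> j /andP[j0 ji]; apply: rX; rewrite j0 (ltn_trans ji im).
move=> x /= /andP[px xi] Xx; have [|j /andP[j0 jm] jx] := Xr x _ Xx.
  by rewrite px (ltn_trans xi) // -rm r_mono.
by exists j => //; rewrite j0 -r_mono jx.
Qed.
End RibbonMinors.

(** * Families of ribbons along the diagonals *)

Section Linked.
Local Open Scope ring_scope.
Variables (m : nat) (al be : nat -> nat).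

Definition indg x j := ((x < m) && (al x <= j <= be x))%N.

(** [al x] and [be x] are the extreme columns of diagonal [x]. The first and last diagonals are
    single cells, the head and the tail of the shape. *)
Definition diag_shape :=
  [/\ (0 < m)%N, forall x, (x < m)%N -> (al x <= be x)%N,
      al 0 = be 0 /\ al m.-1 = be m.-1 &
      forall x, (x.+1 < m)%N ->
        (al x <= al x.+1 <= (al x).+1)%N /\ (be x <= be x.+1 <= (be x).+1)%N].

(* Label i occupies the diagonals p i, ..., w i - 1, in column j of diagonal x
   when lb x j = i; on passing from diagonal x to x+1 its column is shifted by
   one when x+1 is in X and is unchanged otherwise. *)
Definition linked (X : pred nat) k (p w : 'I_k -> 'I_m.+1) (lb : nat -> nat -> 'I_k) :=
  [/\ forall i, (p i < w i)%N,
      forall x j, indg x j -> (p (lb x j) <= x < w (lb x j))%N,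
      forall i x, (p i <= x < w i)%N -> exists2 j, indg x j & lb x j = i,
      forall x j j', indg x j -> indg x j' -> lb x j = lb x j' -> j = j' &
      forall x, (x.+1 < m)%N -> 
      (forall j, indg x j -> indg x.+1 (j + X x.+1)%N -> lb x.+1 (j + X x.+1)%N = lb x j)
      /\ (forall j, indg x.+1 j -> (p (lb x.+1 j) <= x)%N ->
           exists2 j', j = (j' + X x.+1)%N & indg x j' && (lb x j' == lb x.+1 j))].

Hypothesis shape : diag_shape.

(** A column meets a half-open interval of diagonals: it ends at [x] when its top cell lies on
    diagonal [x - 1]. Hence the column of the very last cell ends at [m], one past the last
    diagonal. *)
Definition col_ends x := (x == m) || (0 < x)%N && (al x.-1 < al x)%N.
Definition col_starts x := (x == 0%N) || (x < m)%N && (be x.-1 < be x)%N.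

Section One.
Variables (X : pred nat) (k : nat) (p w : 'I_k -> 'I_m.+1) (lb : nat -> nat -> 'I_k).
Hypothesis lk : linked X p w lb.
Hypothesis X0 : X 0%N = false.
Hypothesis Xm : X m = false.

(** If the shifted column of the last cell of [i] were still in diagonal [x.+1], the label would
    persist beyond [w i]. Because the ends of a diagonal advance by at most one, the shifted column
    can fall outside only at the right end in a right step and at the left end in an up step. *)
Lemma linked_tail i x : (x.+1 < m)%N -> w i = x.+1 :> nat ->
  (if X x.+1 then be x.+1 = be x /\ lb x (be x) = i
   else al x.+1 = (al x).+1 /\ lb x (al x) = i).
Proof.
case: lk => p_w lb_mem lb_ex lb_inj link xm wi.
have [|j jx lbj] := lb_ex i x; first by have := p_w i; rewrite wi; lia.
have [lnk _] := link x xm.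
have nj : ~~ indg x.+1 (j + X x.+1).
  apply/negP => jx'; have := lb_mem _ _ jx'; rewrite lnk // lbj wi; lia.
case: shape => m0 albe _ /(_ x xm) [alS beS]; have := albe _ xm; have xm' := ltnW xm.
move: jx nj; rewrite /indg xm xm' /=; case: (X x.+1) => jx nj h.
  have jbe : j = be x by lia.
  by rewrite -jbe; split=> //; lia.
have jal : j = al x by lia.
by rewrite -jal; split=> //; lia.
Qed.

Lemma linked_last i : w i = m :> nat -> i = lb m.-1 (al m.-1).
Proof.
case: lk => p_w lb_mem lb_ex lb_inj link wi; case: shape => m0 albe [_ e] _.
have [|j jx <-] := lb_ex i m.-1; first by have := p_w i; rewrite wi; lia.
by congr lb; move: jx; rewrite /indg -e; lia.
Qed.

(** The end position determines the last cell, by [linked_tail] or, on the final one-cell diagonal,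
    by [linked_last]; the label of that cell is the ribbon. *)
Lemma linked_w_inj : injective w.
Proof.
move=> i i' ww; have e : w i = w i' :> nat by rewrite ww.
have p_w : (p i < w i)%N by case: lk.
have wm : (w i <= m)%N by rewrite -ltnS.
case: (ltnP (w i) m) => h; last first.
  have {}h : w i = m :> nat by apply/eqP; rewrite eqn_leq wm.
  by rewrite (linked_last h) -(linked_last (etrans (esym e) h)).
have [x wx] : exists x, w i = x.+1 :> nat by exists (w i).-1; rewrite prednK // (leq_trans _ p_w).
have xm : (x.+1 < m)%N by rewrite -wx.
have := linked_tail xm wx; have := linked_tail xm (etrans (esym e) wx).
by case: (X _) => -[_ <-] [_ <-].
Qed.

Lemma linked_noexit i x : (x.+1 < m)%N -> w i = x.+1 :> nat ->
  if X x.+1 then ~~ col_starts x.+1 else col_ends x.+1.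
Proof.
move=> xm wi; have := linked_tail xm wi; rewrite /col_starts /col_ends /= xm.
by case: (X x.+1) => -[-> _]; rewrite ?ltnn // ltnSn orbT.
Qed.

Lemma linked_exit j x : (x.+1 < m)%N -> indg x j -> ~~ indg x.+1 (j + X x.+1) ->
  w (lb x j) = x.+1 :> nat.
Proof.
case: lk => p_w lb_mem lb_ex lb_inj link xm jx nj.
have [_ pred] := link x xm; have /andP[px xw] := lb_mem _ _ jx.
case: (ltngtP (w (lb x j)) x.+1) => // h; first by move: h xw; lia.
have [|j' jx' lbj'] := lb_ex (lb x j) x.+1; first by rewrite h andbT ltnW.
have [|j'' ej' /andP[jx'' /eqP lbj'']] := pred _ jx'; first by rewrite lbj'.
have e : j = j'' by apply: (lb_inj x) => //; rewrite lbj'' lbj'.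
by move: nj; rewrite e -ej' jx'.
Qed.

Lemma linked_enter j x : (x.+1 < m)%N -> indg x.+1 j ->
  (forall j', j = (j' + X x.+1)%N -> ~~ indg x j') ->
  p (lb x.+1 j) = x.+1 :> nat.
Proof.
case: lk => p_w lb_mem lb_ex lb_inj link xm jx nj.
have [_ pred] := link x xm; have /andP[px xw] := lb_mem _ _ jx.
case: (ltngtP (p (lb x.+1 j)) x.+1) => // h; last by move: h px; lia.
have [|j' e /andP[jx' _]] := pred _ jx; first by [].
by have := nj _ e; rewrite jx'.
Qed.

Variables (R : comNzRingType) (T : nat -> nat -> R).

Definition eRow x : 'rV[R]_m.+1 := \row_y (x == y :> nat)%:R.
Definition tRow x : 'rV[R]_m.+1 := \row_y T x y.
Definition uRow x : 'rV[R]_m.+1 := if X x then eRow x else tRow x.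
Definition vRow x : 'rV[R]_m.+1 := if X x then tRow x else eRow x.
Definition gRow x : 'rV[R]_m.+1 :=
  if [pick i | w i == x :> nat] is Some i then uRow (p i) else vRow x.
(** These are the ribbons that meet diagonal [x - 1], that is, those with start before [x] and end
    at [x] or later, listed in column order. *)
Definition active x : seq 'rV[R]_m.+1 :=
  if (0 < x <= m)%N then [seq uRow (p (lb x.-1 j)) | j <- iota (al x.-1) ((be x.-1).+1 - al x.-1)]
  else [::].

Lemma gRow_in i : gRow (w i) = uRow (p i).
Proof.
rewrite /gRow; case: pickP => [i' /eqP/val_inj/linked_w_inj -> //|/(_ i)].
by rewrite eqxx.
Qed.

Lemma gRow_out x : (forall i, w i <> x :> nat) -> gRow x = vRow x.
Proof. by move=> nw; rewrite /gRow; case: pickP => // i /eqP /nw. Qed.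

(** All columns shift by one. If the right end of the diagonal stays, the ribbon in the last column
    drops out and supplies [gRow x]. If the left end stays, the first column has no predecessor, so
    a ribbon starts there, and its row is a unit vector since [x] is in [X]. *)
Lemma active_right_step x : (x <= m)%N -> X x ->
  right_step col_ends col_starts eRow tRow gRow active x.
Proof.
case: x => [|x]; first by rewrite X0.
rewrite leq_eqVlt => /predU1P[->|xm Xx]; first by rewrite Xm.
have xm' := ltnW xm; have xm'' := ltnW xm'.
case: lk => p_w lb_mem lb_ex lb_inj /(_ x xm) [lnk _].
case: shape => m0 albe _ /(_ x xm) [alS beS].
have albx := albe x xm'; have albx1 := albe _ xm.
pose M := [seq uRow (p (lb x j)) | j <- iota (al x) (be x.+1 - al x)].
exists M.
  rewrite /active /= xm'; case: ifP => col_starts_x.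
    congr map; congr iota; move: col_starts_x beS; rewrite /col_starts /= xm /=; lia.
  have e : be x.+1 = be x by move: col_starts_x beS; rewrite /col_starts /= xm /=; lia.
  have jx : indg x (be x) by rewrite /indg xm' albx leqnn.
  have <- : w (lb x (be x)) = x.+1 :> nat.
    by apply: linked_exit => //; rewrite /indg Xx e; lia.
  rewrite gRow_in -map_rcons e subSn // -[X in iota _ X]addn1 iotaD cats1.
  by rewrite /= subnKC.
split=> [col_starts_x|].
  rewrite gRow_out /vRow ?Xx // => i wi.
  by have := linked_noexit xm wi; rewrite Xx col_starts_x.
rewrite /active /= xm.
have -> : M = [seq uRow (p (lb x.+1 j)) | j <- iota (al x).+1 (be x.+1 - al x)].
  rewrite -[(al x).+1]addn1 addnC iotaDl -map_comp; apply/eq_in_map => j.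
  rewrite mem_iota /= => /andP[aj jb]; congr (uRow (p _)).
  have := lnk j; rewrite Xx /= add1n addn1 => -> //; rewrite /indg ?xm ?xm'; lia.
case: ifP => col_ends_x; move: col_ends_x; rewrite /col_ends ltn_eqF //= => col_ends_x.
  by have -> : al x.+1 = (al x).+1 by lia.
have e : al x.+1 = al x by lia.
rewrite e subSn /= -?e //; congr cons; rewrite /uRow linked_enter ?Xx //.
  by rewrite /indg xm albx1 leqnn.
by move=> j'; rewrite ?Xx e /indg; lia.
Qed.

(** Columns are kept. If the left end of the diagonal advances, the first ribbon drops out; if the
    right end advances, a ribbon with row [T x] starts in the new last column. The one-cell first
    and last diagonals settle positions 0 and [m]. *)
Lemma active_up_step x : (x <= m)%N -> X x = false ->
  up_step col_ends col_starts eRow tRow gRow active x.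
Proof.
case: lk => p_w lb_mem lb_ex lb_inj link.
case: shape => m0 albe [al0 alm] stp.
case: x => [_ _|x].
  rewrite /up_step /active m0 /= /col_ends /col_starts /= orbF eq_sym [(m == 0)%N]gtn_eqF //=.
  rewrite al0 subSnn /=.
  rewrite gRow_out /vRow ?X0; last by move=> i; have := p_w i; lia.
  have jx : indg 0 (be 0) by rewrite /indg m0 al0 leqnn.
  have := lb_mem _ _ jx; rewrite leqn0 => /andP[/eqP e _].
  by rewrite /uRow e X0.
rewrite leq_eqVlt => /predU1P[xm _|xm Xx].
  have xm' : (x < m)%N by rewrite -xm.
  have mx : m.-1 = x by rewrite -xm.
  rewrite /up_step /active xm m0 leqnn ltnn andbF /= /col_ends eqxx /col_starts ltnn gtn_eqF //=.
  rewrite cats0 mx; move: alm; rewrite mx => ->; rewrite subSnn /=.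
  have jx : indg x (be x) by rewrite /indg xm' albe /=.
  have /andP[_ xw] := lb_mem _ _ jx.
  have e : w (lb x (be x)) = m :> nat by have := ltn_ord (w (lb x (be x))); lia.
  by have := gRow_in (lb x (be x)); rewrite e => ->.
have xm' := ltnW xm; have xm'' := ltnW xm'.
have [lnk _] := link x xm; have [alS beS] := stp x xm.
have albx := albe x xm'; have albx1 := albe _ xm.
rewrite Xx in lnk.
pose M := [seq uRow (p (lb x j)) | j <- iota (al x.+1) ((be x).+1 - al x.+1)].
rewrite /up_step; have -> : active x.+2 = M ++ (if col_starts x.+1 then [:: tRow x.+1] else [::]).
  have -> : M = [seq uRow (p (lb x.+1 j)) | j <- iota (al x.+1) ((be x).+1 - al x.+1)].
    apply/eq_in_map => j; rewrite mem_iota => jb; congr (uRow (p _)).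
    by rewrite -[j in RHS]addn0 lnk // /indg; move: jb; lia.
  rewrite /active /= xm; case: ifP => col_starts_x; last first.
    by rewrite cats0; congr map; congr iota; move: col_starts_x beS; rewrite /col_starts /= xm /=; lia.
  have e : be x.+1 = (be x).+1 by move: col_starts_x beS; rewrite /col_starts /= xm /=; lia.
  have <- : uRow (p (lb x.+1 (be x.+1))) = tRow x.+1.
    rewrite /uRow linked_enter ?Xx //; first by rewrite /indg xm albx1 leqnn.
    by move=> j'; rewrite ?Xx e /indg; lia.
  rewrite cats1 -map_rcons; congr map.
  have -> : ((be x.+1).+1 - al x.+1 = (be x).+1 - al x.+1 + 1)%N by lia.
  by rewrite iotaD cats1 /= e subnKC //; lia.
rewrite -cat_cons; congr cat.
rewrite /active /= xm'; case: ifP; rewrite /col_ends ltn_eqF //= => col_ends_x.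
  have e : al x.+1 = (al x).+1 by lia.
  have jx : indg x (al x) by rewrite /indg xm' albx leqnn.
  have <- : w (lb x (al x)) = x.+1 :> nat.
    by apply: linked_exit => //; rewrite /indg Xx e; lia.
  have -> : ((be x).+1 - al x = ((be x).+1 - al x.+1).+1)%N by lia.
  by rewrite gRow_in /M e.
rewrite gRow_out; last first.
  by move=> i wi; have := linked_noexit xm wi; rewrite Xx /col_ends ltn_eqF //= col_ends_x.
rewrite /vRow Xx /M; congr (_ :: map _ (iota _ (_ - _))); lia.
Qed.

Lemma size_active x : (x < m)%N -> size (active x.+1) = #|[pred i | (p i <= x < w i)%N]|.
Proof.
case: lk => p_w lb_mem lb_ex lb_inj _ xm.
rewrite /active /= xm size_map size_iota.
have -> : ((be x).+1 - al x)%N = size [seq lb x j | j <- iota (al x) ((be x).+1 - al x)].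
  by rewrite size_map size_iota.
have inI j : (j \in iota (al x) ((be x).+1 - al x)) = indg x j.
  by rewrite mem_iota /indg xm; lia.
rewrite -(card_uniqP _) ?map_inj_in_uniq ?iota_uniq //; last first.
  by move=> j j'; rewrite !inI; apply: lb_inj.
apply: eq_card => i; rewrite [in RHS]inE /=; apply/mapP/idP => [[j]|].
  by rewrite inI => jx ->; apply: lb_mem.
by move=> /lb_ex [j jx <-]; exists j; rewrite ?inI.
Qed.

(** Both exponents count, modulo 2, the pairs of a ribbon [i] and an element [x] of [X] with
    [p i <= x < w i]: once by diagonals, once by ribbons. *)
Lemma active_sign :
  (-1) ^+ (\sum_(x < m.+1 | X x) size (active x.+1)) =
  (\prod_i xsign R X (p i)) * (\prod_i xsign R X (w i)).
Proof.
have p_w : forall i, (p i < w i)%N by case: lk.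
rewrite -big_split /= (eq_bigr (fun i : 'I_k => (-1) ^+ count X (iota (p i) (w i - p i)))); last first.
  by move=> i _; rewrite xsign_mul // ltnW.
rewrite prodrXr; congr (_ ^+ _).
transitivity (\sum_(x < m.+1 | X x) \sum_(i < k | (p i <= x < w i)%N) 1)%N.
  apply: eq_bigr => x Xx; rewrite sum1_card size_active //.
  by have := ltn_ord x; rewrite ltnS leq_eqVlt => /predU1P[xm|//]; move: Xx; rewrite xm Xm.
rewrite (exchange_big_dep predT) //=; apply: eq_bigr => i _.
rewrite -sum1_count -/(index_iota _ _) (@big_nat_widen _ _ _ _ _ m.+1) ?(ltnW (ltn_ord _)) //.
rewrite (@big_nat_widenl _ _ _ _ 0) // big_mkord; apply: eq_bigl => x.
by rewrite -!andbA; congr (_ && _); rewrite andbC.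
Qed.

Hypothesis T1 : forall x, T x x = 1.
Hypothesis T0 : forall x y, (y < x)%N -> T x y = 0.

(** The signs in [ribQ] come out as two diagonal factors; the rest is [det_replace_rows] applied to
    [U] times the inverse of [V]. *)
Lemma det_ribQ_minor :
  \det (\matrix_(i < k, j < k) ribQ X T m.+1 (p i) (w j)) =
  (\prod_i xsign R X (p i)) * (\prod_i xsign R X (w i)) *
  det_rows (mkseq gRow m.+1).
Proof.
set U := Umx X T m.+1; set V := Vmx X T m.+1; pose M := U *m \adj V.
have -> : \matrix_(i < k, j < k) ribQ X T m.+1 (p i) (w j) =
    diag_mx (\row_i xsign R X (p i)) *m (\matrix_(i, j) M (p i) (w j)) *m
    diag_mx (\row_i xsign R X (w i)).
  apply/matrixP => i j; rewrite mul_mx_diag mul_diag_mx !mxE.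
  by rewrite mulrAC.
rewrite !det_mulmx !det_diag.
rewrite (@det_replace_rows _ _ _ _ U V) //; first last.
- exact: linked_w_inj.
- exact: det_Vmx.
- by rewrite -mulmxA mul_adj_mx det_Vmx // mulmx1.
under eq_bigr do rewrite mxE.
under [X in _ * _ * X]eq_bigr do rewrite mxE.
rewrite mulrAC; congr (_ * _).
congr (\det _); apply/row_matrixP => x; rewrite !rowK nth_mkseq // /gRow.
have rU y : row y U = uRow y by apply/rowP => z; rewrite /uRow !mxE; case: ifP; rewrite !mxE.
have rV y : row y V = vRow y by apply/rowP => z; rewrite /vRow !mxE; case: ifP; rewrite !mxE.
rewrite (eq_pick (Q := fun i => w i == x :> nat)) //.
by case: pickP.
Qed.

End One.

Lemma ribQ_pred0 (R : comNzRingType) (T : nat -> nat -> R) n (p w : 'I_n) :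
  ribQ pred0 T n p w = T p w.
Proof.
have -> : ribQ pred0 T n = \matrix_(i, j) T i j.
  apply/matrixP => i j; rewrite [LHS]mxE /xsign !count_pred0 !mul1r.
  have -> : Vmx pred0 T n = 1%:M by apply/matrixP => a b; rewrite !mxE.
  by rewrite adj1 mulmx1 !mxE.
by rewrite mxE.
Qed.

Theorem linked_minor (R : comNzRingType) (T : nat -> nat -> R)
    (X : pred nat) k (p w : 'I_k -> 'I_m.+1) lb
    N (D W : 'I_N -> 'I_m.+1) lc :
  (forall x, T x x = 1) -> (forall x y, (y < x)%N -> T x y = 0) ->
  X 0%N = false -> X m = false ->
  linked X p w lb -> linked pred0 D W lc ->
  \det (\matrix_(i < N, j < N) T (D i) (W j)) =
  \det (\matrix_(i < k, j < k) ribQ X T m.+1 (p i) (w j)).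
Proof.
move=> T1 T0 X0 Xm lk lc0.
have -> : \matrix_(i < N, j < N) T (D i) (W j) =
    \matrix_(i < N, j < N) ribQ pred0 T m.+1 (D i) (W j).
  by apply/matrixP => i j; rewrite [LHS]mxE [RHS]mxE ribQ_pred0.
rewrite (det_ribQ_minor lc0) // (det_ribQ_minor lk) //.
rewrite -(active_sign lk X0 Xm T) -(active_sign lc0 _ _ T) // big_pred0 // mul1r.
rewrite (@det_rows_sweep _ _ X col_ends col_starts (eRow R) (tRow T) (gRow X p w T) (gRow pred0 D W T)
  (active X p lb T) (active pred0 D lc T)) //.
- by rewrite mulrA -expr2 sqrr_sign mul1r.
- by move=> x xm; apply: active_up_step.
- move=> x xm; case: ifP => Xx; first exact: active_right_step.
  exact: active_up_step.
- by rewrite /active ltnn andbF.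
Qed.

End Linked.

(** * Ribbons as Hessenberg minors *)

Lemma bigminn_leq (I : eqType) (s : seq I) (P : pred I) (F : I -> nat) d i :
  i \in s -> P i -> \big[minn/d]_(j <- s | P j) F j <= F i.
Proof.
elim: s => // a s IH; rewrite inE big_cons => /predU1P[<- -> | /IH h /h le].
  exact: geq_minl.
by case: ifP => // _; rewrite geq_min le orbT.
Qed.

Lemma leq_bigminn (I : eqType) (s : seq I) (P : pred I) (F : I -> nat) d m :
  m <= d -> (forall i, i \in s -> P i -> m <= F i) ->
  m <= \big[minn/d]_(j <- s | P j) F j.
Proof.
move=> md; elim: s => [|a s IH] mF; first by rewrite big_nil.
have h : m <= \big[minn/d]_(j <- s | P j) F j.
  by apply: IH => i si; apply: mF; rewrite inE si orbT.
rewrite big_cons; case: ifP => // Pa.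
by rewrite leq_min h mF // inE eqxx.
Qed.

Lemma bigminn_ord_eq L d (P : pred nat) (F : nat -> nat) b :
  b < L -> P b -> F b <= d -> (forall t, t < L -> P t -> F b <= F t) ->
  \big[minn/d]_(t < L | P t) F t = F b.
Proof.
move=> bL Pb bd minb; apply/eqP; rewrite eqn_leq.
rewrite (@bigminn_leq _ _ (fun t : 'I_L => P t) (fun t : 'I_L => F t) d (Ordinal bL))
  ?mem_index_enum //=.
by apply: leq_bigminn => // i _; apply: minb.
Qed.

Lemma bigmax_ord_eq L (P : pred nat) (F : nat -> nat) b :
  b < L -> P b -> (forall t, t < L -> P t -> F t <= F b) ->
  \max_(t < L | P t) F t = F b.
Proof.
move=> bL Pb maxb; apply/eqP; rewrite eqn_leq; apply/andP; split.
  by apply/bigmax_leqP => i; apply: maxb.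
by apply: (@leq_bigmax_cond _ _ (fun t : 'I_L => F t) (Ordinal bL)).
Qed.

Lemma colLen_mkseq f n k j : k <= n -> (forall i, i < n -> (j <= f i) = (i < k)) ->
  colLen (mkseq f n) j = k.
Proof.
move=> kn fk; rewrite /colLen /mkseq count_map -(subnKC kn) iotaD count_cat.
rewrite (eq_in_count (a2 := predT)) => [|i]; last first.
  by rewrite mem_iota /= => ik; rewrite fk ?ik // (leq_trans ik).
rewrite count_predT size_iota (eq_in_count (a2 := pred0)) => [|i]; last first.
  rewrite mem_iota add0n subnKC //= => /andP[ki ii].
  by rewrite fk // ltnNge ki.
by rewrite count_pred0 addn0.
Qed.

Section Ribbon.
Variables (u : int -> bool) (p : int) (L : nat).
Hypothesis L0 : 0 < L.
Local Notation nu := (nups u p).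
Local Notation rows := (rib_rows u p L).
Local Notation cols := (rib_cols u p L).
Local Notation row := (rib_row u p L).
Local Notation col := (rib_col u p).

Lemma nupsS t : nu t.+1 = nu t + u (p + t%:Z)%R.
Proof. by rewrite /nups big_ord_recr. Qed.

Lemma nups0 : nu 0 = 0.
Proof. by rewrite /nups big_ord0. Qed.

Lemma nups_leq s t : s <= t -> nu s <= nu t <= nu s + (t - s).
Proof.
move=> /subnKC <-; elim: (t - s) => [|d IH]; first by rewrite addn0 subnn addn0 leqnn.
move: IH; rewrite addnS nupsS; case: (u _) => /=; lia.
Qed.

Lemma nups_le t : nu t <= t.
Proof. by have := nups_leq (leq0n t); rewrite nups0 subn0 => /andP[]. Qed.

(** A discrete intermediate value property: the count grows by at most one per step. It provides a
    ribbon cell in any prescribed row. *)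
Lemma nups_ivt s t v : s <= t -> nu s <= v <= nu t -> exists2 x, s <= x <= t & nu x = v.
Proof.
move=> st; have e : t = s + (t - s) by rewrite subnKC.
move: e st; move: (t - s) => d; elim: d t => [|d IH] t -> _.
  by rewrite addn0 => h; exists s; [rewrite leqnn | lia].
rewrite addnS nupsS => h; case: (leqP v (nu (s + d))) => vd.
  have [|x xs xv] := IH _ erefl (leq_addr _ _); first lia.
  by exists x => //; lia.
exists (s + d).+1; first lia.
rewrite nupsS; case: (u _) in h *; rewrite /= in h *; lia.
Qed.

Lemma rib_col_leq s t : s <= t -> col s <= col t.
Proof.
move=> st; move: (nups_leq st); rewrite /rib_col.
by have := nups_le s; have := nups_le t; lia.
Qed.

Lemma rib_row_geq s t : s <= t -> row t <= row s.
Proof. by move=> /nups_leq; rewrite /rib_row; lia. Qed.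

Lemma rib_colS t : col t.+1 = col t + ~~ u (p + t%:Z)%R.
Proof. rewrite /rib_col nupsS; have := nups_le t; case: (u _) => /=; lia. Qed.

Lemma rib_col0 : col 0 = 1. Proof. by rewrite /rib_col nups0. Qed.

Lemma rib_col_last : col L.-1 = cols.
Proof. by rewrite /rib_col /rib_cols. Qed.

Lemma rib_first i : i < cols -> exists2 b, b < L /\ col b = i.+1 & forall t, col t = i.+1 -> b <= t.
Proof.
move=> ic; have ex : exists t, i < col t by exists L.-1; rewrite rib_col_last.
case: (ex_minnP ex) => b ib bmin.
have bL : b < L by rewrite -ltnS -(prednK L0) ltnS ltnS bmin // rib_col_last.
exists b; last by move=> t ct; apply: bmin; rewrite ct.
split=> //; case: b => [|b] in ib bmin bL *; first by move: ib; rewrite rib_col0; lia.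
have : col b <= i by rewrite leqNgt; apply/negP => /bmin; rewrite ltnn.
by move: ib; rewrite rib_colS; case: (u _) => /=; lia.
Qed.

Lemma rib_bot_offP i : i < cols -> let b := rib_bot_off u p L i.+1 in
  [/\ b < L, col b = i.+1 & forall t, col t = i.+1 -> b <= t].
Proof.
move=> ic; have [b [bL cb] bmin] := rib_first ic.
rewrite /rib_bot_off (@bigminn_ord_eq L L (fun t => col t == i.+1) id b) //.
- by rewrite cb.
- exact: ltnW.
by move=> t _ /eqP; apply: bmin.
Qed.

Lemma rib_bot_off0 : rib_bot_off u p L 1 = 0.
Proof.
have [|bL cb] := @rib_bot_offP 0; first by rewrite /rib_cols.
by move=> /(_ 0); rewrite rib_col0 => /(_ erefl); rewrite leqn0 => /eqP.
Qed.

(** Past the last column the minimum is over an empty set and takes its default [L]. This serves as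
    a sentinel: the next column would start right after the final cell. *)
Lemma rib_bot_off_last : rib_bot_off u p L cols.+1 = L.
Proof.
rewrite /rib_bot_off big_pred0 // => t; apply/eqP => ct.
by have := @rib_col_leq t L.-1; rewrite rib_col_last ct ltnn -ltnS prednK // => /(_ (ltn_ord t)).
Qed.

Lemma rib_bot_off_inc i j : i < j <= cols ->
  rib_bot_off u p L i.+1 < rib_bot_off u p L j.+1.
Proof.
move=> /andP[ij]; have ic : i < cols -> _ := @rib_bot_offP i.
rewrite leq_eqVlt => /predU1P[jc|jc].
  by rewrite jc rib_bot_off_last; have [|] := ic; rewrite -?jc.
have [|bL cb _] := ic; first exact: ltn_trans ij jc.
have [_ cb' _] := rib_bot_offP jc.
rewrite ltnNge; apply/negP => /rib_col_leq; rewrite cb cb'; lia.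
Qed.

(** A column top is followed immediately by the next column bottom. The entry in row [i] and column
    [j] thus depends on the bottoms of columns [i] and [j.+1], which is the pattern of
    [det_hessenberg]. *)
Lemma rib_top_offP j : j < cols -> let t := rib_top_off u p L j.+1 in
  [/\ t.+1 = rib_bot_off u p L j.+2, t < L, col t = j.+1 &
      forall x, x < L -> col x = j.+1 -> x <= t].
Proof.
move=> jc; have [bL cb bmin] := rib_bot_offP jc.
have main t : t.+1 = rib_bot_off u p L j.+2 -> t < L -> col t = j.+1 ->
  (forall x, x < L -> col x = j.+1 -> x <= t) -> rib_top_off u p L j.+1 = t.
  move=> tb tL ct tmax.
  rewrite /rib_top_off (@bigmax_ord_eq L (fun t => col t == j.+1) id t) //; first by rewrite ct.
  by move=> x xL /eqP; apply: tmax.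
suff [t [tb tL ct tmax]] : exists t, [/\ t.+1 = rib_bot_off u p L j.+2, t < L,
    col t = j.+1 & forall x, x < L -> col x = j.+1 -> x <= t].
  by rewrite (main t).
have inc : rib_bot_off u p L j.+1 < rib_bot_off u p L j.+2.
  by apply: rib_bot_off_inc; rewrite ltnSn.
exists (rib_bot_off u p L j.+2).-1.
move: jc; rewrite leq_eqVlt => /predU1P[jc|jc].
  rewrite jc rib_bot_off_last prednK // rib_col_last; split=> //.
  by move=> x; rewrite -{1}(prednK L0).
have [bL' cb' bmin'] := rib_bot_offP jc.
move: inc bL' cb' bmin'; case: (rib_bot_off _ _ _ j.+2) => // b inc bL' cb' bmin' /=.
have cbj : col b = j.+1.
  move: cb'; rewrite rib_colS; case: (u _) => /= e; last lia.
  by have := bmin' b; rewrite -e addn0 ltnn => /(_ erefl).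
split=> // [|x _ cx]; first exact: ltnW.
by rewrite leqNgt; apply/negP => /rib_col_leq; rewrite cx cb' ltnn.
Qed.

Lemma colLen_rib_lam i : i < cols ->
  colLen (rib_lam u p L) i.+1 = row (rib_bot_off u p L i.+1).
Proof.
move=> ic; have [bL cb bmin] := rib_bot_offP ic; set b := rib_bot_off u p L i.+1 in bL cb bmin *.
apply: colLen_mkseq => [|r rr]; first exact: leq_subr.
apply/idP/idP => [h|rb].
  have [t tr tc] : exists2 t : 'I_L, row t == r.+1 & i < col t.
    apply/exists_inP; move: h; apply: contraLR; rewrite negb_exists_in => /forall_inP h.
    by rewrite -ltnNge ltnS; apply/bigmax_leqP => t /h; rewrite -leqNgt.
  rewrite -(eqP tr) rib_row_geq // leqNgt; apply/negP => tb.
  have := bmin t; rewrite leqNgt tb => h'.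
  suff : col t = i.+1 by move=> /h'.
  by apply/eqP; rewrite eqn_leq tc -cb rib_col_leq // ltnW.
have bL' : b <= L.-1 by rewrite -ltnS prednK.
have [|t /andP[bt tL] nt] := nups_ivt (v := rows - r.+1) bL'.
  by move: rb rr; rewrite /rib_row /rib_rows; have := nups_leq bL'; lia.
have tL' : t < L by rewrite -(prednK L0) ltnS.
apply: leq_trans (leq_bigmax_cond (F := fun t : 'I_L => col t) (Ordinal tL') _) => /=.
  by rewrite -cb rib_col_leq.
by rewrite /rib_row nt subKn.
Qed.

Lemma colLen_rib_mu j : j < cols ->
  (colLen (rib_mu u p L) j.+1).+1 = row (rib_top_off u p L j.+1).
Proof.
move=> jc; have [_ tL ct tmax] := rib_top_offP jc; set t := rib_top_off u p L j.+1 in tL ct tmax *.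
have tL' : t <= L.-1 by rewrite -ltnS prednK.
have row_t : 0 < row t <= rows.
  by rewrite /rib_row /rib_rows; have := nups_leq tL'; lia.
rewrite -[RHS]prednK; last by case/andP: row_t.
congr _.+1; apply: colLen_mkseq => [|r rr]; first by move: row_t; lia.
have -> : (r < (row t).-1) = (r.+1 < row t) by move: row_t; lia.
have -> (m : nat) : (j < m.-1) = (j.+1 < m) by lia.
have [|x /andP[_ xL] nx] := nups_ivt (v := rows - r.+1) (leq0n L.-1).
  by move: rr; rewrite nups0 /rib_rows; lia.
have xL' : x < L by rewrite -(prednK L0) ltnS.
have rx : row x = r.+1 by rewrite /rib_row nx subKn.
have key y : y < L -> row y < row t -> j.+1 < col y.
  move=> yL ry; have ty : t < y.
    by rewrite ltnNge; apply/negP => /rib_row_geq; rewrite leqNgt ry.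
  rewrite ltn_neqAle -{2}ct rib_col_leq ?(ltnW ty) // andbT eq_sym.
  by apply/eqP => /(tmax y yL); rewrite leqNgt ty.
apply/idP/idP => [h|rt].
  rewrite ltnNge; apply/negP => tr.
  have [|y /andP[_ yt] ny] := nups_ivt (v := rows - r.+1) (leq0n t).
    by move: rr tr row_t; rewrite nups0 /rib_row /rib_rows; lia.
  have yL : y < L by apply: leq_ltn_trans yt tL.
  have ry : row y == r.+1 by rewrite /rib_row ny subKn.
  have := bigminn_leq (P := fun t : 'I_L => row t == r.+1) (fun t : 'I_L => col t) cols
    (mem_index_enum (Ordinal yL)) ry.
  move=> /(leq_trans h); rewrite ltnNge -ct => /negP; apply.
  exact: rib_col_leq.
apply: leq_bigminn => [|y _ /eqP ry]; last by apply: key; rewrite ?ry.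
apply: leq_trans (key x xL' _) _; rewrite ?rx // -rib_col_last.
exact: rib_col_leq.
Qed.

(** The offset of a ribbon cell is its number of up steps plus its number of right steps, so column
    lengths and column indices combine into offsets: the degree becomes [t + 1 - s] and the contents
    become [p + t] and [p + s]. *)
Lemma Sdet_ribbon (R : comNzRingType) (a b : seq int) (y z : int -> R) :
  size a = cols ->
  Sdet (rib_lam u p L) (rib_mu u p L) p a b y z =
  (\det (\matrix_(i < cols, j < cols)
    let s := rib_bot_off u p L i.+1 in let t := rib_top_off u p L j.+1 in
    esup (t.+1%:Z - s%:Z) (yseg y (nth 0 a j) (nth 0 b i))
      (yseg z (nth 0 a j + (p + t%:Z)) (nth 0 b i + (p + s%:Z)))))%R.
Proof.
move=> sa; rewrite /Sdet sa; congr (\det _)%R; apply/matrixP => i j; rewrite !mxE.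
have cL1 : colLen (rib_lam u p L) 1 = rows.
  by rewrite colLen_rib_lam // rib_bot_off0 /rib_row nups0 subn0.
have [bL cb _] := rib_bot_offP (ltn_ord i).
have [_ tL ct _] := rib_top_offP (ltn_ord j).
have row_le t : t < L -> nu t < rows.
  by move=> tL'; rewrite ltnS; have /andP[] := @nups_leq t L.-1 (ltac:(lia)).
have ei := colLen_rib_lam (ltn_ord i); have ej := colLen_rib_mu (ltn_ord j).
have := row_le _ bL; have := row_le _ tL; have := nups_le (rib_bot_off u p L i.+1).
have := nups_le (rib_top_off u p L j.+1).
rewrite /fl /content; cbn [fst snd predn]; rewrite cL1 ei; move: ej cb ct; rewrite /rib_row /rib_col.
set s := rib_bot_off _ _ _ _; set t := rib_top_off _ _ _ _; set mu := colLen _ _.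
move=> ej cb ct h1 h2 h3 h4.
congr (esup _ (yseg _ _ _) (yseg _ (_ + _) (_ + _)))%R; lia.
Qed.

(** With [rib_bot_off_surj], this identifies the column bottoms other than the first with the
    offsets entered by a right step, i.e. with the elements of [X] inside the ribbon. *)
Lemma rib_bot_off_right i : 0 < i < cols -> u (p + (rib_bot_off u p L i.+1)%:Z - 1)%R = false.
Proof.
move=> /andP[i0 ic]; have [bL cb bmin] := rib_bot_offP ic.
have b0 : 0 < rib_bot_off u p L i.+1 by rewrite -{1}rib_bot_off0 rib_bot_off_inc // i0 ltnW.
move: b0 bL cb bmin; case: (rib_bot_off _ _ _ _) => // b _ bL cb bmin.
have -> : (p + b.+1%:Z - 1 = p + b%:Z)%R by lia.
apply/negbTE/negP => ub; have := bmin b; rewrite ltnn.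
by move: cb; rewrite rib_colS ub addn0 => -> /(_ erefl).
Qed.

Lemma rib_bot_off_surj x : 0 < x < L -> u (p + x%:Z - 1)%R = false ->
  exists2 i, 0 < i < cols & rib_bot_off u p L i.+1 = x.
Proof.
case: x => // x; rewrite ltnS leq0n /= => xL.
have -> : (p + x.+1%:Z - 1 = p + x%:Z)%R by lia.
move=> ux; have cx : col x.+1 = (col x).+1 by rewrite rib_colS ux addn1.
have cc : col x < cols by rewrite -cx -rib_col_last rib_col_leq // -ltnS prednK.
exists (col x); first by rewrite cc andbT.
have [bL cb bmin] := rib_bot_offP cc.
apply/eqP; rewrite eqn_leq bmin //=.
by rewrite leqNgt ltnS; apply/negP => /rib_col_leq; rewrite cb ltnn.
Qed.

End Ribbon.

(** * Connected convex sets of cells *)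

Lemma bigmax_attained (I : eqType) (s : seq I) (P : pred I) (F : I -> nat) :
  has P s -> exists2 x, (x \in s) && P x & F x = \max_(x <- s | P x) F x.
Proof.
elim: s => //= a s IH; rewrite big_cons; case Pa: (P a) => /=; last first.
  by move=> /IH [x /andP[xs Px] <-]; exists x; rewrite ?inE ?xs ?Px ?orbT.
move=> _; case: (boolP (has P s)) => [/IH [x /andP[xs Px] <-]|/hasPn nP].
  case: (leqP (F a) (F x)) => h; first by exists x; rewrite ?inE ?xs ?Px ?orbT.
  by exists a; rewrite ?inE ?eqxx ?Pa.
exists a; rewrite ?inE ?eqxx ?Pa // big1_seq ?maxn0 // => x /andP[Px xs].
by have := nP x xs; rewrite Px.
Qed.

Lemma bigminn_attained (I : eqType) (s : seq I) (P : pred I) (F : I -> nat) d :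
  (forall x, x \in s -> P x -> F x <= d) ->
  has P s -> exists2 x, (x \in s) && P x & F x = \big[minn/d]_(x <- s | P x) F x.
Proof.
elim: s => //= a s IH Fd; rewrite big_cons.
have {}IH := IH (fun x xs => Fd x (mem_behead (s := a :: s) xs)).
case Pa: (P a) => /=; last first.
  by move=> /IH [x /andP[xs Px] <-]; exists x; rewrite ?inE ?xs ?Px ?orbT.
move=> _; case: (boolP (has P s)) => [/IH [x /andP[xs Px] <-]|nP].
  case: (leqP (F a) (F x)) => h; last by exists x; rewrite ?inE ?xs ?Px ?orbT.
  by exists a; rewrite ?inE ?eqxx ?Pa.
exists a; rewrite ?inE ?eqxx ?Pa //; rewrite big_hasC //.
by apply/esym/minn_idPl/Fd; rewrite ?inE ?eqxx.
Qed.

Section CellSets.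
Variable cs : seq cell.
Hypotheses (conn : edge_connected cs) (conv : skew_convex cs) (cs0 : cs != [::]).

Lemma head_cell_min :
  head_cell cs \in cs /\ forall z, z \in cs ->
    z.1 <= (head_cell cs).1 /\ (z.1 = (head_cell cs).1 -> (head_cell cs).2 <= z.2).
Proof.
have hasT : has predT cs by rewrite has_predT lt0n size_eq0.
have [x xcs xm] := bigmax_attained (fst : cell -> nat) hasT.
rewrite /head_cell; set rm := \max_(x <- cs) x.1 in xm *; set d := \max_(x <- cs) x.2.
have hasP : has (fun x : cell => x.1 == rm) cs.
  by apply/hasP; exists x; [case/andP: xcs | rewrite /= xm].
have [|c /andP[ccs /eqP cr] cm] := @bigminn_attained _ cs (fun x => x.1 == rm) snd d _ hasP.
  by move=> y ycs _; apply: leq_bigmax_seq.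
rewrite -cm -cr -surjective_pairing; split=> // z zcs; split.
  by rewrite cr; apply: leq_bigmax_seq.
by move=> zc; rewrite cm; apply: bigminn_leq; rewrite // zc cr.
Qed.

Lemma tail_cell_max :
  tail_cell cs \in cs /\ forall z, z \in cs ->
    (tail_cell cs).1 <= z.1 /\ (z.1 = (tail_cell cs).1 -> z.2 <= (tail_cell cs).2).
Proof.
have hasT : has predT cs by rewrite has_predT lt0n size_eq0.
rewrite /tail_cell; set d := \max_(x <- cs) x.1; set rm := \big[minn/d]_(x <- cs) x.1.
have [|x xcs xm] := @bigminn_attained _ cs predT fst d _ hasT.
  by move=> y ycs _; apply: leq_bigmax_seq.
have hasP : has (fun x : cell => x.1 == rm) cs.
  by apply/hasP; exists x; [case/andP: xcs | rewrite /= xm].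
have [c /andP[ccs /eqP cr] cm] := bigmax_attained (snd : cell -> nat) hasP.
rewrite -cm -cr -surjective_pairing; split=> // z zcs; split.
  by rewrite cr; apply: bigminn_leq.
by move=> zc; rewrite cm; apply: leq_bigmax_seq; rewrite // zc cr.
Qed.

(** If [z] lay strictly left of the head, convexity would put into the set a cell in the row of the
    head and left of it. *)
Lemma head_cell_sw z : z \in cs -> z.1 <= (head_cell cs).1 /\ (head_cell cs).2 <= z.2.
Proof.
move=> zcs; have [hcs hmin] := head_cell_min; have [zh _] := hmin z zcs.
split=> //; case: leqP => // h2.
have mid : ((head_cell cs).1, z.2) \in cs.
  by apply: (conv (x := z) (z := head_cell cs)); rewrite //= ?leqnn ?zh ?(ltnW h2).
by have [_ /(_ erefl)] := hmin _ mid; rewrite leqNgt h2.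
Qed.

Lemma tail_cell_ne z : z \in cs -> (tail_cell cs).1 <= z.1 /\ z.2 <= (tail_cell cs).2.
Proof.
move=> zcs; have [hcs hmin] := tail_cell_max; have [zh _] := hmin z zcs.
split=> //; case: leqP => // h2.
have mid : ((tail_cell cs).1, z.2) \in cs.
  by apply: (conv (x := tail_cell cs) (z := z)); rewrite //= ?leqnn ?zh ?(ltnW h2).
by have [_ /(_ erefl)] := hmin _ mid; rewrite leqNgt h2.
Qed.

Lemma connected_exit (P : pred cell) x y : x \in cs -> y \in cs -> P x -> ~~ P y ->
  exists v v', [/\ v \in cs, v' \in cs, P v, ~~ P v' & adjacent v v'].
Proof.
move=> xcs ycs Px Py; have [s [ps als lst]] := conn xcs ycs.
elim: s x xcs Px ps als lst => [|a s IH] x xcs Px /= ps als lst.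
  by move: Py; rewrite -lst Px.
case/andP: ps => xa ps; case/andP: als => acs als.
case Pa: (P a); first exact: IH acs Pa ps als lst.
by exists x, a; rewrite xcs acs Px Pa.
Qed.

(* Leaving the north-east quadrant of z inside the set forces, by convexity, a
   cell directly left of or below z. *)
Lemma left_or_below z : z \in cs -> z != head_cell cs ->
  (exists2 j, z.2 = j.+1 & (z.1, j) \in cs) \/ (z.1.+1, z.2) \in cs.
Proof.
move=> zcs zh; have [hcs hmin] := head_cell_min.
pose Q (y : cell) := (y.1 <= z.1) && (z.2 <= y.2).
have Qh : ~~ Q (head_cell cs).
  have [z1 z2] := head_cell_sw zcs; apply/negP => /andP[h1 h2]; move: zh.
  by rewrite -pair_eqE /pair_eq (anti_leq (introT andP (conj z1 h1)))
     (anti_leq (introT andP (conj h2 z2))) !eqxx.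
have [|v [v' [vcs v'cs Qv Qv' adj]]] := connected_exit zcs hcs _ Qh.
  by rewrite /Q !leqnn.
move: Qv Qv' adj; rewrite /Q /adjacent => /andP[v1 v2] Qv' adj.
have [[e1 e2]|[e1 e2]] : (v.2 = z.2 /\ v = (v'.1, v'.2.+1)) \/ (v.1 = z.1 /\ v' = (v.1.+1, v.2)).
  case: v v' v1 v2 Qv' adj {vcs v'cs} => [v1 v2] [v1' v2'] /=.
  move: (z.1) (z.2) => z1 z2 h1 h2 h3 h4.
  have [[*]|[*]] : (v2 = z2 /\ v1 = v1' /\ v2 = v2'.+1) \/ (v1 = z1 /\ v1' = v1.+1 /\ v2' = v2).
    by case/orP: h4 => /andP[/eqP h4 /orP[/eqP h5|/eqP h5]]; move: h3; rewrite negb_and -!ltnNge; lia.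
    by left; split; [|congr (_, _)]; lia.
  by right; split; [|congr (_, _)]; lia.
- left; exists v'.2; first by rewrite -e1 e2.
  apply: (conv (x := v') (z := z)) => //=; rewrite ?leqnn ?andbT /=.
    by move: v1; rewrite e2.
  by rewrite -e1 e2 leqnSn.
right; apply: (conv (x := z) (z := v')) => //=; rewrite e2 /= ?e1 ?leqnn ?andbT ?leqnSn //.
Qed.

Lemma right_or_above z : z \in cs -> z != tail_cell cs ->
  (exists2 i, z.1 = i.+1 & (i, z.2) \in cs) \/ (z.1, z.2.+1) \in cs.
Proof.
move=> zcs zh; have [hcs hmin] := tail_cell_max.
pose Q (y : cell) := (z.1 <= y.1) && (y.2 <= z.2).
have Qh : ~~ Q (tail_cell cs).
  have [z1 z2] := tail_cell_ne zcs; apply/negP => /andP[h1 h2]; move: zh.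
  by rewrite -pair_eqE /pair_eq (anti_leq (introT andP (conj z2 h2)))
     (anti_leq (introT andP (conj h1 z1))) !eqxx.
have [|v [v' [vcs v'cs Qv Qv' adj]]] := connected_exit zcs hcs _ Qh.
  by rewrite /Q !leqnn.
move: Qv Qv' adj; rewrite /Q /adjacent => /andP[v1 v2] Qv' adj.
have [[e1 e2]|[e1 e2]] : (v.1 = z.1 /\ v = (v'.1.+1, v'.2)) \/ (v.2 = z.2 /\ v' = (v.1, v.2.+1)).
  case: v v' v1 v2 Qv' adj {vcs v'cs} => [v1 v2] [v1' v2'] /=.
  move: (z.1) (z.2) => z1 z2 h1 h2 h3 h4.
  have [[*]|[*]] : (v1 = z1 /\ v1 = v1'.+1 /\ v2 = v2') \/ (v2 = z2 /\ v2' = v2.+1 /\ v1' = v1).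
    by case/orP: h4 => /andP[/eqP h4 /orP[/eqP h5|/eqP h5]]; move: h3; rewrite negb_and -!ltnNge; lia.
    by left; split; [|congr (_, _)]; lia.
  by right; split; [|congr (_, _)]; lia.
- left; exists v'.1; first by rewrite -e1 e2.
  apply: (conv (x := v') (z := z)) => //=; rewrite ?leqnn ?andbT /=.
    by rewrite -e1 e2 leqnSn.
  by move: v2; rewrite e2.
right; apply: (conv (x := z) (z := v')) => //=; rewrite e2 /= ?e1 ?leqnn ?andbT ?leqnSn //.
Qed.

End CellSets.

(** * Contents of the cells of a convex set *)

Section Content.
Variables (lam : seq nat) (r : int) (cs : seq cell).
Local Notation ct := (content lam r).
Hypothesis conv : skew_convex cs.

(** Of two cells with equal content in different rows, one lies strictly below and to the right of
    the other; convexity then fills in a 2 by 2 block. *)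
Lemma content_inj : no_2x2 cs -> {in cs &, injective ct}.
Proof.
move=> n2; have key (z z' : cell) : z \in cs -> z' \in cs -> ct z = ct z' -> z'.1 <= z.1.
  move=> zcs z'cs; rewrite /content => e; case: leqP => // z1.
  have z2 : z.2 < z'.2 by lia.
  have mid y : z.1 <= y.1 <= z'.1 -> z.2 <= y.2 <= z'.2 -> y \in cs by apply: conv zcs z'cs.
  by have := n2 z; rewrite zcs !mid //= ?leqnn ?leqnSn ?(ltnW z1) ?(ltnW z2) ?z1 ?z2.
move=> z z' zcs z'cs e; have := key _ _ zcs z'cs e; have := key _ _ z'cs zcs (esym e).
move: e; rewrite /content; case: z z' {zcs z'cs} => [a b] [a' b'] /= *; congr (_, _); lia.
Qed.

Hypotheses (conn : edge_connected cs) (cs0 : cs != [::]).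

Lemma content_head_tail z : z \in cs ->
  (ct (head_cell cs) <= ct z <= ct (tail_cell cs))%R.
Proof.
move=> zcs; have := head_cell_sw conv cs0 zcs; have := tail_cell_ne conv cs0 zcs.
rewrite /content; case: z zcs => a b _; case: (head_cell cs) => c d.
case: (tail_cell cs) => e f /=; lia.
Qed.

Lemma content_range c : (ct (head_cell cs) <= c <= ct (tail_cell cs))%R ->
  exists2 z, z \in cs & ct z = c.
Proof.
move=> /andP[hc]; have -> : c = (ct (head_cell cs) + (absz (c - ct (head_cell cs)))%:Z)%R by lia.
elim: (absz _) => [|x IH] xt.
  by exists (head_cell cs); [case: (head_cell_min cs0) | rewrite addr0].
have [|z zcs zx] := IH; first lia.
have zt : z != tail_cell cs by apply/eqP => e; move: xt; rewrite -e; lia.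
have [[i zi ics]|zr] := right_or_above conn conv cs0 zcs zt.
  by exists (i, z.2) => //; move: zx; rewrite /content /= zi; lia.
by exists (z.1, z.2.+1) => //; move: zx; rewrite /content /=; lia.
Qed.

End Content.

Lemma rowLen_colLen lam i j : is_partition lam -> 0 < i -> 0 < j ->
  (j <= rowLen lam i) = (i <= colLen lam j).
Proof.
rewrite /is_partition /rowLen /colLen => + i0 j0; case: i i0 => // i _ /=.
elim: lam i => [|a l IH] i srt; first by rewrite nth_nil leqNgt j0.
have {}IH := IH _ (path_sorted srt).
have la : all (geq a) l by apply: order_path_min srt => x y z /= h1 h2; apply: leq_trans h2 h1.
case: i => [|i] /=.
  case: (leqP j a) => // ja; rewrite add0n.
  rewrite (@eq_in_count _ _ pred0) ?count_pred0 // => x xl /=.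
  by apply/negbTE; rewrite -ltnNge (leq_ltn_trans _ ja) //; apply: (allP la).
rewrite IH; case: (leqP j a) => // ja.
rewrite (@eq_in_count _ _ pred0) ?count_pred0 // => x xl /=.
by apply/negbTE; rewrite -ltnNge (leq_ltn_trans _ ja) //; apply: (allP la).
Qed.

Lemma rowLen_anti lam i i' : is_partition lam -> 0 < i -> i <= i' ->
  rowLen lam i' <= rowLen lam i.
Proof.
move=> par i0 ii'; case: (posnP (rowLen lam i')) => [->//|h].
by rewrite rowLen_colLen // (leq_trans ii') // -rowLen_colLen // (leq_trans i0).
Qed.

Lemma colLen_anti lam j j' : j <= j' -> colLen lam j' <= colLen lam j.
Proof. by move=> jj'; apply: sub_count => x /=; apply: leq_trans. Qed.

Lemma pairwise_allpairs (s t : seq nat) : pairwise leq s ->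
  pairwise (fun x y : cell => x.2 <= y.2) [seq (i, j) | j <- s, i <- t].
Proof.
elim: s => //= a s IH /andP[als ps]; rewrite pairwise_cat IH // andbT.
apply/andP; split.
  apply/allrelP => x y /mapP[i _ ->] /allpairsP[[j' i'] /= [js _ ->]] /=.
  by apply: (allP als).
by elim: t {IH} => //= i t ->; rewrite andbT; apply/allP => x /mapP[i' _ ->] /=.
Qed.

Section Shape.
Variables (lam mu : seq nat) (r : int).
Hypothesis ok : skew_ok lam mu.
Hypothesis conn : edge_connected (skew_cells lam mu).
Local Notation cs := (skew_cells lam mu).
Local Notation ct := (content lam r).

Lemma mem_skew_cells z : (z \in cs) = in_skew lam mu z.
Proof.
rewrite /skew_cells mem_filter; case: (boolP (in_skew _ _ _)) => // /and3P[i0 mj jl] /=.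
case: ok => pl pm _; apply/allpairsP; exists (z.2, z.1) => /=; split; last by case: (z).
  rewrite mem_iota add1n ltnS (leq_ltn_trans _ mj) //=.
  by apply: leq_trans jl _; apply: rowLen_anti.
rewrite mem_iota i0 add1n ltnS /=; case: leqP => // h.
by move: jl; rewrite /rowLen nth_default; [rewrite leqNgt (leq_ltn_trans _ mj) | lia].
Qed.

Lemma in_skew_col i j : in_skew lam mu (i, j) = (0 < j) && (colLen mu j < i <= colLen lam j).
Proof.
case: ok => pl pm _; rewrite /in_skew /=.
case: (posnP j) => [->|j0]; first by rewrite ltn0 andbF.
case: (posnP i) => [->|i0] //=.
by rewrite ltnNge !rowLen_colLen // -ltnNge.
Qed.

Lemma colLen_sub j : 0 < j -> colLen mu j <= colLen lam j.
Proof.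
case: ok => pl pm sub j0; case: (posnP (colLen mu j)) => [->//|h].
by rewrite -rowLen_colLen // (leq_trans _ (sub _)) // rowLen_colLen.
Qed.

Lemma skew_cells_convex : skew_convex cs.
Proof.
case: ok => pl pm _ x y z; rewrite !mem_skew_cells /in_skew => /and3P[x1 xm xl] /and3P[z1 zm zl].
move=> /andP[xy1 yz1] /andP[xy2 yz2]; have y1 := leq_trans x1 xy1; rewrite y1 /=.
rewrite (leq_ltn_trans (rowLen_anti pm x1 xy1) (leq_trans xm xy2)) /=.
exact: leq_trans yz2 (leq_trans zl (rowLen_anti pl y1 yz1)).
Qed.

(** [skew_cells] lists the cells column by column, so the first one of a given content is the
    leftmost. *)
Lemma leftmost_cellP c z : z \in cs -> ct z = c ->
  [/\ leftmost_cell lam mu r c \in cs, ct (leftmost_cell lam mu r c) = c &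
      (leftmost_cell lam mu r c).2 <= z.2].
Proof.
move=> zcs zc; rewrite /leftmost_cell.
have pw : pairwise (fun x y : cell => x.2 <= y.2) [seq x <- cs | ct x == c].
  do 2 apply: pairwise_filter; apply: pairwise_allpairs.
  by rewrite -sorted_pairwise ?iota_sorted //; apply: leq_trans.
have : z \in [seq x <- cs | ct x == c] by rewrite mem_filter zc eqxx.
have mem y : y \in [seq x <- cs | ct x == c] -> y \in cs /\ ct y = c.
  by rewrite mem_filter => /andP[/eqP].
case: [seq _ <- _ | _] mem pw => // a s mem /= /andP[als _] zs.
have [acs ac] := mem a (mem_head _ _); split=> //.
by move: zs; rewrite inE => /predU1P[->//|/(allP als)].
Qed.

Lemma rightmost_cellP c z : z \in cs -> ct z = c ->
  [/\ rightmost_cell lam mu r c \in cs, ct (rightmost_cell lam mu r c) = c &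
      z.2 <= (rightmost_cell lam mu r c).2].
Proof.
move=> zcs zc; rewrite /rightmost_cell.
have pw : pairwise (fun x y : cell => x.2 <= y.2) [seq x <- cs | ct x == c].
  do 2 apply: pairwise_filter; apply: pairwise_allpairs.
  by rewrite -sorted_pairwise ?iota_sorted //; apply: leq_trans.
have : z \in [seq x <- cs | ct x == c] by rewrite mem_filter zc eqxx.
have mem y : y \in [seq x <- cs | ct x == c] -> y \in cs /\ ct y = c.
  by rewrite mem_filter => /andP[/eqP].
case/lastP: [seq _ <- _ | _] mem pw => // s a mem.
rewrite pairwise_rcons last_rcons => /andP[als _] zs.
have [|acs ac] := mem a; first by rewrite mem_rcons mem_head.
split=> //.
by move: zs; rewrite mem_rcons inE => /predU1P[->//|/(allP als)].
Qed.

End Shape.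

(** * Diagonals of the shape *)

Section Diagonals.
Variables (lam mu : seq nat) (r : int).
Local Notation cs := (skew_cells lam mu).
Local Notation ct := (content lam r).

Definition cmin : int := ct (head_cell cs).
Definition ndiag : nat := (absz (ct (tail_cell cs) - cmin)).+1.
(** Content and column determine the row; for a cell of the shape the integer under [absz] is that
    row. *)
Definition cellat (x j : nat) : cell :=
  (absz (j%:Z - x%:Z - cmin + r - 1 + (colLen lam 1)%:Z)%R, j).
Definition dleft (x : nat) : nat := (leftmost_cell lam mu r (cmin + x%:Z)%R).2.
Definition dright (x : nat) : nat := (rightmost_cell lam mu r (cmin + x%:Z)%R).2.
Local Notation indiag := (indg ndiag dleft dright).

Hypothesis ok : skew_ok lam mu.
Hypothesis conn : edge_connected cs.
Hypothesis cs0 : cs != [::].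

Let conv := skew_cells_convex ok.

Lemma content_cmin z : z \in cs -> ct z = (cmin + (absz (ct z - cmin)%R)%:Z)%R
  /\ absz (ct z - cmin)%R < ndiag.
Proof.
move=> zcs; have := content_head_tail lam r conv cs0 zcs.
by rewrite /ndiag /cmin; lia.
Qed.

Lemma diag_nonempty x : x < ndiag -> exists2 z, z \in cs & ct z = (cmin + x%:Z)%R.
Proof.
move=> xn; apply: (content_range conv conn cs0).
have [hcs _] := head_cell_min cs0.
by have := content_head_tail lam r conv cs0 hcs; move: xn; rewrite /ndiag /cmin; lia.
Qed.

Lemma cellat_eq (i j x : nat) : ct (i, j) = (cmin + x%:Z)%R -> cellat x j = (i, j).
Proof. by rewrite /content /cellat /= => e; congr (_, _); lia. Qed.

Lemma cellat_indiag z x : z \in cs -> ct z = (cmin + x%:Z)%R ->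
  indiag x z.2 /\ cellat x z.2 = z.
Proof.
move=> zcs zx; split; last by case: z zx {zcs} => i j; apply: cellat_eq.
have [_ _ lz] := leftmost_cellP zcs zx; have [_ _ rz] := rightmost_cellP zcs zx.
have [_] := content_cmin zcs.
by rewrite /indg /dleft /dright lz rz zx; lia.
Qed.

Lemma indiag_cellat x j : indiag x j ->
  cellat x j \in cs /\ ct (cellat x j) = (cmin + x%:Z)%R.
Proof.
move=> /and3P[xn lj jr]; have [z zcs zx] := diag_nonempty xn.
have [lcs lx _] := leftmost_cellP zcs zx; have [rcs rx _] := rightmost_cellP zcs zx.
move: lj jr; rewrite /dleft /dright.
move: (leftmost_cell _ _ _ _) (rightmost_cell _ _ _ _) lcs lx rcs rx.
move=> [i1 j1] [i2 j2] lcs lx rcs rx /= lj jr.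
have e : cellat x j = ((i1 + (j - j1))%N, j).
  by move: lx; rewrite /cellat /content /= => lx; congr (_, _); lia.
rewrite e; split; last by move: lx; rewrite /content /=; lia.
apply: (conv lcs rcs) => /=; last by rewrite lj jr.
by move: lx rx; rewrite /content /=; lia.
Qed.

Lemma cellat_row x j : indiag x j -> 0 < (cellat x j).1.
Proof. by move=> /indiag_cellat[]; rewrite mem_skew_cells // => /andP[]. Qed.

Lemma cellatS x j : cellat x.+1 j.+1 = ((cellat x j).1, j.+1).
Proof. by rewrite /cellat /=; congr (_, _); lia. Qed.

Lemma cellat_up x j : indiag x.+1 j -> cellat x j = ((cellat x.+1 j).1.+1, j).
Proof.
move=> jx; have := cellat_row jx; have [_] := indiag_cellat jx.
by rewrite /content /cellat /= => e h; congr (_, _); lia.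
Qed.

Lemma diag_prev x j : indiag x.+1 j ->
  (exists2 j', j = j'.+1 & indiag x j') \/ indiag x j.
Proof.
move=> jx; have [zcs zx] := indiag_cellat jx; set z := cellat x.+1 j in zcs zx.
have zh : z != head_cell cs by apply/eqP => e; move: zx; rewrite e -/cmin; lia.
have [[j' zj zl]|zb] := left_or_below conn conv cs0 zcs zh.
  left; exists j' => //; have [] // := @cellat_indiag (z.1, j') x zl.
  by move: zx; rewrite /content zj; cbn [fst snd]; lia.
right; have [] // := @cellat_indiag (z.1.+1, z.2) x zb.
by move: zx; rewrite /content; cbn [fst snd]; lia.
Qed.

Lemma diag_next x j : x.+1 < ndiag -> indiag x j -> indiag x.+1 j \/ indiag x.+1 j.+1.
Proof.
move=> xn jx; have [zcs zx] := indiag_cellat jx; set z := cellat x j in zcs zx.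
have zh : z != tail_cell cs.
  by apply/eqP => e; move: zx xn; rewrite e /ndiag; lia.
have [[i' zi zl]|zb] := right_or_above conn conv cs0 zcs zh.
  left; have [] // := @cellat_indiag (i', z.2) x.+1 zl.
  by move: zx; rewrite /content zi; cbn [fst snd]; lia.
right; have [] // := @cellat_indiag (z.1, z.2.+1) x.+1 zb.
by move: zx; rewrite /content; cbn [fst snd]; lia.
Qed.

Lemma dleft_dright x : x < ndiag -> dleft x <= dright x.
Proof.
move=> /diag_nonempty [z zcs zx].
have [_ _ lz] := leftmost_cellP zcs zx; have [_ _ rz] := rightmost_cellP zcs zx.
exact: leq_trans lz rz.
Qed.

Lemma diag_shape_skew : diag_shape ndiag dleft dright.
Proof.
split=> //; first exact: dleft_dright.
  have uniq x z0 : x < ndiag -> (forall z, z \in cs -> ct z = (cmin + x%:Z)%R -> z = z0) ->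
      dleft x = dright x.
    move=> /diag_nonempty [z zcs zx] z0P.
    have [lcs lx _] := leftmost_cellP zcs zx; have [rcs rx _] := rightmost_cellP zcs zx.
    by rewrite /dleft /dright (z0P _ lcs lx) (z0P _ rcs rx).
  split.
    apply: (uniq 0 (head_cell cs)) => // z zcs.
    rewrite /cmin addr0; have := head_cell_sw conv cs0 zcs; case: (head_cell cs) => a b.
    by case: z {zcs} => i j; rewrite /content /=; move=> h e; congr (_, _); lia.
  apply: (uniq ndiag.-1 (tail_cell cs)) => // z zcs.
  have [tcs _] := tail_cell_max cs0.
  have := content_head_tail lam r conv cs0 tcs => /andP[h _].
  have -> : (cmin + ndiag.-1%:Z = ct (tail_cell cs))%R by rewrite /ndiag; move: h; rewrite -/cmin; lia.
  have := tail_cell_ne conv cs0 zcs; case: (tail_cell cs) => a b.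
  by case: z {zcs} => i j; rewrite /content /=; move=> ? e; congr (_, _); lia.
move=> x xn; have xn' := ltnW xn.
have in_l y : y < ndiag -> indiag y (dleft y) by move=> yn; rewrite /indg yn leqnn dleft_dright.
have in_r y : y < ndiag -> indiag y (dright y) by move=> yn; rewrite /indg yn leqnn dleft_dright.
have := diag_prev (in_l _ xn); have := diag_prev (in_r _ xn).
have := diag_next xn (in_l _ xn'); have := diag_next xn (in_r _ xn').
rewrite /indg xn xn' /= => h1 h2 h3 h4.
have h3' : dright x.+1 <= (dright x).+1 by case: h3 => [[j' -> /andP[_]]|/andP[_]] //; apply: leqW.
have h4' : dleft x <= dleft x.+1 by case: h4 => [[j' -> /andP[/leqW]]|/andP[]].
lia.
Qed.

End Diagonals.

(** * The columns of the shape as a linked family with no right steps *)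

Section Columns.
Variables (lam mu : seq nat) (r : int).
Local Notation cs := (skew_cells lam mu).
Local Notation ct := (content lam r).
Local Notation cmin := (cmin lam mu r).
Local Notation ndiag := (ndiag lam mu r).
Local Notation dleft := (dleft lam mu r).
Local Notation dright := (dright lam mu r).
Local Notation cellat := (cellat lam mu r).
Local Notation indiag := (indg ndiag dleft dright).

Hypothesis ok : skew_ok lam mu.
Hypothesis conn : edge_connected cs.
Hypothesis cs0 : cs != [::].

Definition col_bot (j : nat) : nat := absz (ct (colLen lam j, j) - cmin)%R.
Definition col_top (j : nat) : nat := (absz (ct ((colLen mu j).+1, j) - cmin)%R).+1.
Definition col_first : nat := dleft 0.
Definition col_last : nat := dright ndiag.-1.
Definition ncols : nat := (col_last - col_first).+1.

Let shape := diag_shape_skew r ok conn cs0.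

Lemma indiag_cols x j : indiag x j -> col_first <= j <= col_last.
Proof.
case: shape => m0 _ _ stp /and3P[xm lj jr].
have l_mono y : y < ndiag -> col_first <= dleft y.
  by elim: y => // y IH ym; apply: leq_trans (IH (ltnW ym)) _; case: (stp y ym) => /andP[].
have r_mono y : x + y < ndiag -> dright x <= dright (x + y).
  elim: y => [|y IH]; first by rewrite addn0.
  rewrite addnS => ym; apply: leq_trans (IH (ltnW ym)) _.
  by case: (stp _ ym) => _ /andP[].
rewrite (leq_trans (l_mono x xm) lj) (leq_trans jr) //.
have := r_mono (ndiag.-1 - x); rewrite subnKC; first by apply; rewrite ltn_predL.
by rewrite -ltnS prednK.
Qed.

Lemma cols_indiag j : col_first <= j <= col_last -> exists x, indiag x j.
Proof.
case: shape => m0 lr [l0 _] stp.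
have main y : y < ndiag -> col_first <= j <= dright y -> exists x, indiag x j.
  elim: y => [|y IH] ym jy.
    by exists 0; rewrite /indg ym l0; move: jy; rewrite /col_first l0.
  case: (leqP j (dright y)) => h; first by apply: IH; [exact: ltnW | move: jy; lia].
  have := lr _ ym; have := stp _ ym; exists y.+1; rewrite /indg ym; lia.
by apply: main; rewrite ltn_predL.
Qed.

Lemma col_nonempty j : col_first <= j <= col_last -> 0 < j /\ colLen mu j < colLen lam j.
Proof.
move=> /cols_indiag [x jx]; have [] := indiag_cellat ok conn cs0 jx.
rewrite mem_skew_cells // in_skew_col // => /and3P[j0 h1 h2] _.
by split=> //; apply: leq_trans h2.
Qed.

Lemma col_botP j : col_first <= j <= col_last ->
  (colLen lam j, j) \in cs /\ ct (colLen lam j, j) = (cmin + (col_bot j)%:Z)%R.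
Proof.
move=> /col_nonempty [j0 h].
have bcs : (colLen lam j, j) \in cs by rewrite mem_skew_cells // in_skew_col // j0 h leqnn.
by split=> //; have [] := content_cmin r ok cs0 bcs.
Qed.

Lemma col_topP j : col_first <= j <= col_last ->
  ((colLen mu j).+1, j) \in cs /\ ct ((colLen mu j).+1, j) = (cmin + (col_top j).-1%:Z)%R.
Proof.
move=> /col_nonempty [j0 h].
have bcs : ((colLen mu j).+1, j) \in cs by rewrite mem_skew_cells // in_skew_col // j0 leqnn.
by split=> //; have [] := content_cmin r ok cs0 bcs.
Qed.

Lemma col_lt j : col_first <= j <= col_last -> col_bot j < col_top j <= ndiag.
Proof.
move=> jc; have [bcs] := col_botP jc; have [tcs] := col_topP jc.
have [_ h] := content_cmin r ok cs0 tcs; have [_ k] := col_nonempty jc.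
by rewrite {2}/col_top h andbT ltnS /content; cbn [fst snd]; rewrite /col_top /=; lia.
Qed.

Lemma indiagE x j : col_first <= j <= col_last -> indiag x j = (col_bot j <= x < col_top j).
Proof.
move=> jc; have [bcs bc] := col_botP jc; have [tcs tc] := col_topP jc.
have [j0 k] := col_nonempty jc; have H := col_lt jc.
apply/idP/idP => [jx|xb].
  have [] := indiag_cellat ok conn cs0 jx.
  rewrite mem_skew_cells // /cellat in_skew_col //; set i := absz _.
  move=> /and3P[_ h1 h2] e; move: H bc tc e; rewrite /content; cbn [fst snd].
  by move: (colLen mu j) (colLen lam j) h1 h2 => a b; lia.
pose i := (colLen lam j - (x - col_bot j))%N.
have ib : colLen mu j < i <= colLen lam j.
  by move: H bc tc k xb; rewrite /i /content; cbn [fst snd]; lia.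
have [||] // := @cellat_indiag lam mu r ok cs0 (i, j) x.
  by rewrite mem_skew_cells // in_skew_col // j0.
by move: H bc tc k xb ib; rewrite /i /content; cbn [fst snd]; lia.
Qed.

Lemma ord_col (i : 'I_ncols) : col_first <= col_first + i <= col_last.
Proof.
have : col_first <= col_last.
  by case: shape => m0 lr _ _; have [z zcs zx] := diag_nonempty (r := r) ok conn cs0 m0;
     have [/indiag_cols] := cellat_indiag ok cs0 zcs zx; lia.
by have := ltn_ord i; rewrite /ncols; lia.
Qed.

Definition col_bot_ord (i : 'I_ncols) : 'I_ndiag.+1 := inord (col_bot (col_first + i)).
Definition col_top_ord (i : 'I_ncols) : 'I_ndiag.+1 := inord (col_top (col_first + i)).

Lemma col_bot_ordE i : col_bot_ord i = col_bot (col_first + i) :> nat.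
Proof. by rewrite inordK // ltnS; have := col_lt (ord_col i); lia. Qed.

Lemma col_top_ordE i : col_top_ord i = col_top (col_first + i) :> nat.
Proof. by rewrite inordK // ltnS; have := col_lt (ord_col i); lia. Qed.

Lemma linked_cols : linked dleft dright pred0 col_bot_ord col_top_ord
  (fun _ j => inord (j - col_first) : 'I_ncols).
Proof.
have lbE x j : indiag x j -> (inord (j - col_first) : 'I_ncols) = j - col_first :> nat.
  by move=> /indiag_cols h; rewrite inordK // /ncols; lia.
have lbE' x j : indiag x j -> col_first + (inord (j - col_first) : 'I_ncols) = j.
  by move=> jx; rewrite (lbE _ _ jx); have := indiag_cols jx; lia.
split.
- by move=> i; rewrite col_bot_ordE col_top_ordE; have := col_lt (ord_col i); lia.
- by move=> x j jx; rewrite col_bot_ordE col_top_ordE (lbE' _ _ jx) -(indiagE x (indiag_cols jx)).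
- move=> i x; rewrite col_bot_ordE col_top_ordE -indiagE ?ord_col // => jx.
  by exists (col_first + i) => //; apply: val_inj; rewrite /= (lbE _ _ jx) addKn.
- by move=> x j j' jx jx' e; rewrite -(lbE' _ _ jx) e (lbE' _ _ jx').
move=> x xm; split=> j jx; first by rewrite addn0.
rewrite col_bot_ordE (lbE' _ _ jx) => h; exists j; first by rewrite addn0.
rewrite eqxx andbT indiagE ?(indiag_cols jx) // h /=.
by have := jx; rewrite (indiagE _ (indiag_cols jx)) => /andP[_ /ltnW].
Qed.

End Columns.

(** * Outer ribbon decompositions *)

Section Ribbons.
Variables (lam mu : seq nat) (r : int) (k : nat) (lab : cell -> 'I_k).
Local Notation cs := (skew_cells lam mu).
Local Notation ct := (content lam r).
Local Notation cmin := (cmin lam mu r).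
Local Notation ndiag := (ndiag lam mu r).
Local Notation dleft := (dleft lam mu r).
Local Notation dright := (dright lam mu r).
Local Notation cellat := (cellat lam mu r).
Local Notation indiag := (indg ndiag dleft dright).
Local Notation th := (ribbon_of lam mu lab).
Local Notation up := (goes_up lam mu lab).
Local Notation right := (goes_right lam mu lab).

Hypothesis ok : skew_ok lam mu.
Hypothesis conn : edge_connected cs.
Hypothesis cs0 : cs != [::].
Hypothesis outer : outer_ribbon_decomp lam mu lab.

Lemma mem_ribbon z i : (z \in th i) = (lab z == i) && (z \in cs).
Proof. by rewrite mem_filter. Qed.

Lemma mem_own_ribbon z : z \in cs -> z \in th (lab z).
Proof. by rewrite mem_ribbon eqxx. Qed.

Lemma same_ribbonE z y : same_ribbon lam mu lab z y = (y \in th (lab z)).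
Proof. by rewrite mem_ribbon mem_skew_cells // andbC. Qed.

Lemma ribbon_inj i : {in th i &, injective ct}.
Proof. by have [[_ _ cv n2] _ _] := outer i; apply: content_inj. Qed.

Lemma ribbon_contents z i : z \in th i ->
  (ct (head_cell (th i)) <= ct z <= ct (tail_cell (th i)))%R.
Proof. by have [[h0 _ cv _] _ _] := outer i; apply: content_head_tail. Qed.

Lemma cellat2 x j : (cellat x j).2 = j. Proof. by []. Qed.

Lemma next_above x j : indiag x j -> indiag x.+1 j ->
  cellat x.+1 j = ((cellat x j).1.-1, j).
Proof. by move=> jx jx1; rewrite (cellat_up ok conn cs0 jx1) [LHS]surjective_pairing. Qed.

Lemma right_cell x j : indiag x j -> ((cellat x j).1, j.+1) \in cs -> indiag x.+1 j.+1.
Proof.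
move=> jx ucs; have [_ zx] := indiag_cellat ok conn cs0 jx.
have [] // := @cellat_indiag lam mu r ok cs0 _ x.+1 ucs.
by move: zx; rewrite /content cellat2; cbn [fst snd]; lia.
Qed.

Lemma cellat_not_tail x j : x.+1 < ndiag -> indiag x j -> cellat x j != tail_cell cs.
Proof.
move=> xn jx; have [_ zx] := indiag_cellat ok conn cs0 jx.
by apply/eqP => e; move: zx xn; rewrite e /ndiag; lia.
Qed.

Lemma goes_upE x j : x.+1 < ndiag -> indiag x j ->
  up (cellat x j) = (((cellat x j).1.-1, j) \in th (lab (cellat x j)))
    || ((cellat x j == tail_cell (th (lab (cellat x j)))) && top_perim lam mu (cellat x j)).
Proof.
by move=> xn jx; rewrite /goes_up (negbTE (cellat_not_tail xn jx)) same_ribbonE.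
Qed.

Lemma goes_rightE x j : x.+1 < ndiag -> indiag x j ->
  right (cellat x j) = (((cellat x j).1, j.+1) \in th (lab (cellat x j)))
    || ((cellat x j == tail_cell (th (lab (cellat x j)))) && right_perim lam mu (cellat x j)).
Proof.
by move=> xn jx; rewrite /goes_right (negbTE (cellat_not_tail xn jx)) same_ribbonE.
Qed.

Lemma right_perimN x j : ((cellat x j).1, j.+1) \in cs ->
  right_perim lam mu (cellat x j) = false.
Proof. by move=> scs; apply/negbF; apply: etrans scs; rewrite mem_skew_cells. Qed.

Lemma top_perimN x j : ((cellat x j).1.-1, j) \in cs ->
  top_perim lam mu (cellat x j) = false.
Proof. by move=> scs; apply/negbF; apply: etrans scs; rewrite mem_skew_cells. Qed.

(** A cell that is not the tail of its ribbon has a successor above or to the right, and not both,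
    since these two have the same content. A ribbon tail lies on the top or right perimeter; lying
    on both would make it the top-right cell of the shape, which the bound on [x] excludes. *)
Lemma goes_right_up x j : x.+1 < ndiag -> indiag x j ->
  right (cellat x j) = ~~ up (cellat x j).
Proof.
move=> xn jx; have [zcs zx] := indiag_cellat ok conn cs0 jx.
have z0 := cellat_row ok conn cs0 jx; have zT := cellat_not_tail xn jx.
have zth := mem_own_ribbon zcs.
have ctu : ct ((cellat x j).1.-1, j) = (ct (cellat x j) + 1)%R.
  by move: z0; rewrite /content cellat2; cbn [fst snd]; lia.
have ctr : ct ((cellat x j).1, j.+1) = (ct (cellat x j) + 1)%R.
  by move: z0; rewrite /content cellat2; cbn [fst snd]; lia.
have [[h0 cn cv _] _ perim] := outer (lab (cellat x j)).
rewrite goes_upE // goes_rightE //.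
case: (eqVneq (cellat x j) (tail_cell _)) => [e|ne]; rewrite ?orbF.
  have nu : ((cellat x j).1.-1, j) \notin th (lab (cellat x j)).
    by apply/negP => /ribbon_contents; rewrite -e ctu; lia.
  have nr : ((cellat x j).1, j.+1) \notin th (lab (cellat x j)).
    by apply/negP => /ribbon_contents; rewrite -e ctr; lia.
  rewrite (negbTE nu) (negbTE nr) /=; move: perim; rewrite -e.
  case: (boolP (top_perim _ _ _)) => tp; case: (boolP (right_perim _ _ _)) => // rp _.
  have [[i zi ics]|zr] := right_or_above conn (skew_cells_convex ok) cs0 zcs zT.
    by move: tp; rewrite /top_perim zi /= -mem_skew_cells // ics.
  by move: rp; rewrite /right_perim -mem_skew_cells // zr.
case: (boolP (_ \in _)) => rth; case: (boolP (_ \in _)) => uth //; last first.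
  have [[i zi ics]|zr] := right_or_above cn cv h0 zth ne.
    by move: uth; rewrite zi /= ics.
  by move: rth; rewrite zr.
by have := ribbon_inj uth rth (etrans ctu (esym ctr)) => -[]; lia.
Qed.


Lemma ribbon_left_or_below x j : x.+1 < ndiag -> indiag x.+1 j ->
  cellat x.+1 j != head_cell (th (lab (cellat x.+1 j))) ->
  (exists2 j', j = j'.+1 &
     [/\ indiag x j', lab (cellat x j') = lab (cellat x.+1 j) & ~~ up (cellat x j')]) \/
  [/\ indiag x j, lab (cellat x j) = lab (cellat x.+1 j) & up (cellat x j)].
Proof.
move=> xn jx; have [zcs zx] := indiag_cellat ok conn cs0 jx; set z := cellat x.+1 j in zcs zx * => zh.
have [[h0 cn cv _] _ _] := outer (lab z).
have [[j' zj zl]|zb] := left_or_below cn cv h0 (mem_own_ribbon zcs) zh.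
  have := zl; rewrite mem_ribbon => /andP[/eqP ll lcs].
  have [|jx' e] := @cellat_indiag lam mu r ok cs0 _ x lcs.
    by move: zx; rewrite /content zj; cbn [fst snd]; move: (z.1) => i; lia.
  left; exists j' => //; rewrite e; split=> //; rewrite -e.
  rewrite -goes_right_up // goes_rightE // e ll /=; apply/orP; left.
  by have := mem_own_ribbon zcs; rewrite {1}[z]surjective_pairing zj.
have := zb; rewrite mem_ribbon => /andP[/eqP ll lcs].
have [|jx' e] := @cellat_indiag lam mu r ok cs0 _ x lcs.
  by move: zx; rewrite /content; cbn [fst snd]; move: (z.1) (z.2) => i j'; lia.
right; rewrite -[j]/(z.2) e; split=> //; rewrite -e goes_upE // e ll /=.
by have := mem_own_ribbon zcs; rewrite {1}[z]surjective_pairing => ->.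
Qed.

(** The cell right of the first one is also the cell above the second one. If the first goes right
    and the second up, all three share a ribbon, which then repeats a content. *)
Lemma goes_upS x j : x.+1 < ndiag -> indiag x j -> indiag x j.+1 ->
  up (cellat x j) = up (cellat x j.+1).
Proof.
move=> xn jx jx1.
have [zcs zx] := indiag_cellat ok conn cs0 jx; have [ycs yx] := indiag_cellat ok conn cs0 jx1.
have scs : ((cellat x j).1, j.+1) \in cs.
  apply: (skew_cells_convex ok zcs ycs) => /=; rewrite ?leqnn ?leqnSn ?andbT //=.
  by move: zx yx; rewrite /content /=; lia.
have sx := right_cell jx scs.
case u1: (up _); case u2: (up _) => //; last first.
  have := goes_right_up xn jx; rewrite u1 goes_rightE // right_perimN // andbF orbF.
  rewrite mem_ribbon => /andP[/eqP l1 _].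
  have e : ((cellat x j.+1).1.-1, j.+1) = ((cellat x j).1, j.+1).
    by rewrite -next_above // cellatS.
  have := u2; rewrite goes_upE // top_perimN ?e // andbF orbF mem_ribbon => /andP[/eqP l2 _].
  have := mem_own_ribbon ycs; rewrite -l2 l1 => yth.
  by have := ribbon_inj (mem_own_ribbon zcs) yth (etrans zx (esym yx)) => -[_]; lia.
(* Now neither cell leads into the common neighbour. It cannot be a ribbon head, having cells of the
   shape to its left and below, and it cannot have a predecessor in its ribbon either. *)
have [sh|sh] := eqVneq (cellat x.+1 j.+1) (head_cell (th (lab (cellat x.+1 j.+1)))).
  have [_ + _] := outer (lab (cellat x.+1 j.+1)); rewrite -sh.
  have -> : left_perim lam mu (cellat x.+1 j.+1) = false.
    by rewrite /left_perim cellatS //; apply: negbF; apply: etrans zcs; rewrite mem_skew_cells.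
  have -> // : bottom_perim lam mu (cellat x.+1 j.+1) = false.
  rewrite /bottom_perim; apply: negbF; apply: etrans ycs; rewrite mem_skew_cells //.
  by rewrite (cellat_up ok conn cs0 sx).
have [[j' [<-] [_ _]]|[_ _]] := ribbon_left_or_below xn sx sh; first by rewrite u1.
by rewrite u2.
Qed.

Lemma dir_upE x j : x.+1 < ndiag -> indiag x j ->
  dir_up lam mu r lab (cmin + x%:Z)%R = up (cellat x j).
Proof.
move=> xn jx.
have const j1 j2 : indiag x j1 -> indiag x (j1 + j2) -> up (cellat x j1) = up (cellat x (j1 + j2)).
  move=> jx1; elim: j2 => [|j2 IH]; rewrite ?addn0 // addnS => jx2.
  have jx3 : indiag x (j1 + j2) by move: jx1 jx2; rewrite /indg; lia.
  by rewrite IH // goes_upS.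
rewrite /dir_up; apply/hasP/idP => [[z zcs /andP[/eqP zx uz]]|uz].
  have [zd e] := cellat_indiag ok cs0 zcs zx; move: uz; rewrite -e.
  case: (leqP z.2 j) => h; first by rewrite (const z.2 (j - z.2)) // subnKC.
  by rewrite -(subnKC (ltnW h)) -const // subnKC // ltnW.
by have [zcs zx] := indiag_cellat ok conn cs0 jx; exists (cellat x j); rewrite // zx eqxx.
Qed.

Definition rib_start (i : 'I_k) : nat := absz (ct (head_cell (th i)) - cmin)%R.
Definition rib_end (i : 'I_k) : nat := (absz (ct (tail_cell (th i)) - cmin)%R).+1.
Definition rib_start_ord i : 'I_ndiag.+1 := inord (rib_start i).
Definition rib_end_ord i : 'I_ndiag.+1 := inord (rib_end i).
(** Membership of [x] records the step that leaves content [x - 1]. The bounds make it false at 0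
    and at [ndiag], so the direction of the last content is never consulted. *)
Definition right_steps (x : nat) : bool :=
  [&& 0 < x, x < ndiag & ~~ dir_up lam mu r lab (cmin + x%:Z - 1)%R].

Lemma rib_startP i : (ct (head_cell (th i)) = cmin + (rib_start i)%:Z)%R /\
  (ct (tail_cell (th i)) = cmin + (rib_end i)%:Z - 1)%R /\ rib_start i < rib_end i <= ndiag.
Proof.
have [[h0 _ cv _] _ _] := outer i.
have [hth _] := head_cell_min h0; have [tth _] := tail_cell_max h0.
have := ribbon_contents hth; move: hth tth; rewrite !mem_ribbon => /andP[_ hcs] /andP[_ tcs].
have := content_cmin r ok cs0 hcs; have := content_cmin r ok cs0 tcs.
by rewrite /rib_start /rib_end; lia.
Qed.

Lemma rib_start_ordE i : rib_start_ord i = rib_start i :> nat.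
Proof. by rewrite inordK // ltnS; have [_ [_]] := rib_startP i; lia. Qed.

Lemma rib_end_ordE i : rib_end_ord i = rib_end i :> nat.
Proof. by rewrite inordK // ltnS; have [_ [_]] := rib_startP i; lia. Qed.

Lemma linked_ribbons :
  linked dleft dright right_steps rib_start_ord rib_end_ord (fun x j => lab (cellat x j)).
Proof.
split.
- by move=> i; rewrite rib_start_ordE rib_end_ordE; have [_ [_ /andP[]]] := rib_startP i.
- move=> x j jx; rewrite rib_start_ordE rib_end_ordE.
  have [zcs zx] := indiag_cellat ok conn cs0 jx.
  have := ribbon_contents (mem_own_ribbon zcs); have := rib_startP (lab (cellat x j)).
  by rewrite zx; lia.
- move=> i x; rewrite rib_start_ordE rib_end_ordE => xi.
  have [[h0 cn cv _] _ _] := outer i; have := rib_startP i => ip.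
  have [|z] := @content_range lam r _ cv cn h0 (cmin + x%:Z)%R; first by move: ip xi; lia.
  rewrite mem_ribbon => /andP[/eqP zi zcs] zx.
  have [zd e] := cellat_indiag ok cs0 zcs zx.
  by exists z.2 => //; rewrite e.
- move=> x j j' jx jx' e.
  have [zcs zx] := indiag_cellat ok conn cs0 jx; have [ycs yx] := indiag_cellat ok conn cs0 jx'.
  have := mem_own_ribbon ycs; rewrite -e => yth.
  by have := ribbon_inj (mem_own_ribbon zcs) yth (etrans zx (esym yx)) => -[].
move=> x xn.
have XE j : indiag x j -> right_steps x.+1 = ~~ up (cellat x j).
  move=> jx; rewrite /right_steps xn /= -dir_upE //; congr (~~ dir_up _ _ _ _ _); lia.
split=> j jx; [move=> jx1|rewrite rib_start_ordE => hx].
  have [zcs zx] := indiag_cellat ok conn cs0 jx.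
  move: jx1; rewrite (XE _ jx); case u: (up _) => /=.
    rewrite addn0 => jx1; have [scs _] := indiag_cellat ok conn cs0 jx1.
    have e := next_above jx jx1; rewrite e in scs.
    by move: u; rewrite goes_upE // top_perimN // andbF orbF mem_ribbon e => /andP[/eqP].
  rewrite addn1 => jx1; have [scs _] := indiag_cellat ok conn cs0 jx1.
  rewrite cellatS // in scs *.
  move: (goes_right_up xn jx); rewrite u goes_rightE // right_perimN // andbF orbF.
  by rewrite mem_ribbon => /andP[/eqP].
have [|[j' e [jx' l u]]|[jx' l u]] := ribbon_left_or_below xn jx.
- apply/eqP => e; have [_ zx] := indiag_cellat ok conn cs0 jx.
  by have [e' _] := rib_startP (lab (cellat x.+1 j)); move: zx; rewrite [in LHS]e e'; lia.
- by exists j'; rewrite ?(XE _ jx') ?u ?addn1 // jx' l eqxx.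
by exists j; rewrite ?(XE _ jx') ?u ?addn0 // jx' l eqxx.
Qed.

End Ribbons.

(** * The theorem *)

Section JacobiTrudi.
Variables (R : comNzRingType) (lam mu : seq nat) (r : int).
Variables (af bf : seq int) (y z : int -> R).
Local Notation cs := (skew_cells lam mu).
Local Notation ct := (content lam r).
Local Notation cmin := (cmin lam mu r).
Local Notation ndiag := (ndiag lam mu r).
Local Notation dleft := (dleft lam mu r).
Local Notation dright := (dright lam mu r).
Local Notation indiag := (indg ndiag dleft dright).
Local Notation col_first := (col_first lam mu r).
Local Notation col_last := (col_last lam mu r).
Local Notation ncols := (ncols lam mu r).

Lemma esup_neg n (v w : seq R) : (n < 0)%R -> esup n v w = 0%R.
Proof. by rewrite /esup => ->. Qed.

Lemma esup0 (v w : seq R) : esup 0 v w = 1%R.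
Proof.
rewrite /esup ltxx big_ord1 subn0 expr0 mul1r.
have -> : Defs.esym v 0 = 1%R.
  rewrite /Defs.esym (eq_bigl (pred1 set0)) ?big_pred1_eq ?big_set0 //.
  by move=> I; rewrite cards_eq0.
rewrite mul1r /hsym (eq_bigl (pred1 [tuple])) ?big_pred1_eq ?big_nil //.
by move=> t; rewrite tuple0 /=; apply/esym/eqP.
Qed.

Definition flag_a (w : nat) : int :=
  nth 0%R af (leftmost_cell lam mu r (cmin + w%:Z - 1)%R).2.-1.
Definition flag_b (x : nat) : int :=
  let M := rightmost_cell lam mu r (cmin + x%:Z)%R in
  (nth 0%R bf M.2.-1 - (colLen lam M.2)%:Z + M.1%:Z)%R.

(* A column whose bottom cell lies on diagonal x and whose top cell lies on
   diagonal w - 1. *)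
Definition jt_entry (x w : nat) : R :=
  esup (w%:Z - x%:Z)%R (yseg y (flag_a w) (flag_b x))
    (yseg z (flag_a w + (cmin + w%:Z - 1))%R (flag_b x + (cmin + x%:Z))%R).

Lemma jt_entry_diag x : jt_entry x x = 1%R.
Proof. by rewrite /jt_entry subrr esup0. Qed.

Lemma jt_entry_lt x w : w < x -> jt_entry x w = 0%R.
Proof. by move=> wx; rewrite /jt_entry esup_neg //; lia. Qed.

Definition skew_entry (i j : nat) : R :=
  let i1 := i.+1 in let j1 := j.+1 in
  esup ((colLen lam i1)%:Z - i1%:Z - (colLen mu j1)%:Z + j1%:Z)%R
    (yseg y (fl af j1) (fl bf i1))
    (yseg z (fl af j1 + ct ((colLen mu j1).+1, j1))%R (fl bf i1 + ct (colLen lam i1, i1))%R).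

Lemma skew_entry_diag i : colLen lam i.+1 = colLen mu i.+1 -> skew_entry i i = 1%R.
Proof.
move=> e; rewrite /skew_entry e.
have -> : ((colLen mu i.+1)%:Z - i.+1%:Z - (colLen mu i.+1)%:Z + i.+1%:Z = 0)%R by lia.
exact: esup0.
Qed.

Lemma skew_entry_lt i j : j < i -> colLen lam i.+1 <= colLen mu j.+1 -> skew_entry i j = 0%R.
Proof. by move=> ji h; rewrite /skew_entry esup_neg //; lia. Qed.

Lemma Sdet_empty_cols : (forall j, colLen lam j.+1 = colLen mu j.+1) ->
  Sdet lam mu r af bf y z = 1%R.
Proof.
move=> e; apply: (@det_mx_unitrig R (size af) skew_entry) => [a _|a b /andP[ba _]].
  exact: skew_entry_diag.
by rewrite skew_entry_lt // -e colLen_anti // ltnS ltnW.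
Qed.

Hypothesis ok : skew_ok lam mu.

Lemma colLen_empty j : 0 < j -> (forall i, (i, j) \notin cs) -> colLen lam j = colLen mu j.
Proof.
move=> j0 nj; apply/eqP; rewrite eqn_leq (colLen_sub ok j0) andbT leqNgt; apply/negP => h.
by have := nj (colLen lam j); rewrite mem_skew_cells // in_skew_col // j0 h leqnn.
Qed.

Hypothesis conn : edge_connected cs.
Hypothesis cs0 : cs != [::].
Hypothesis size_af : rowLen lam 1 <= size af.

(** A cell further left on the same diagonal is also higher, and convexity would then place the cell
    just above the top of column [j] in the shape. *)
Lemma leftmost_top j : col_first <= j <= col_last ->
  (leftmost_cell lam mu r (cmin + (col_top lam mu r j)%:Z - 1)%R).2 = j.
Proof.
move=> jc; have [tcs tc] := col_topP ok conn cs0 jc; have [j0 _] := col_nonempty ok conn cs0 jc.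
have -> : (cmin + (col_top lam mu r j)%:Z - 1 = cmin + (col_top lam mu r j).-1%:Z)%R.
  by rewrite /col_top /=; lia.
have [lcs lc le] := leftmost_cellP tcs tc.
apply/eqP; rewrite eqn_leq le /= leqNgt; apply/negP => lt.
have : (colLen mu j, j) \in cs.
  apply: (skew_cells_convex ok lcs tcs) => /=; last by rewrite leqnn ltnW.
  rewrite leqnSn andbT; move: lc lt; rewrite -tc /content /=.
  by move: (leftmost_cell _ _ _ _) => [a b] /=; lia.
by rewrite mem_skew_cells // in_skew_col // ltnn andbF.
Qed.

(** Dual to [leftmost_top]. Since the row found is [colLen lam j], the correction in [flag_b]
    vanishes and the flag of the column itself remains. *)
Lemma rightmost_bot j : col_first <= j <= col_last ->
  rightmost_cell lam mu r (cmin + (col_bot lam mu r j)%:Z)%R = (colLen lam j, j).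
Proof.
move=> jc; have [bcs bc] := col_botP ok conn cs0 jc; have [j0 k] := col_nonempty ok conn cs0 jc.
have [rcs rc re] := rightmost_cellP bcs bc.
have e2 : (rightmost_cell lam mu r (cmin + (col_bot lam mu r j)%:Z)%R).2 = j.
  apply/eqP; rewrite eqn_leq re andbT leqNgt; apply/negP => lt.
  have : ((colLen lam j).+1, j) \in cs.
    apply: (skew_cells_convex ok bcs rcs) => /=; last by rewrite leqnn ltnW.
    rewrite leqnSn /=; move: rc lt; rewrite -bc /content /=.
    by move: (rightmost_cell _ _ _ _) => [a b] /=; lia.
  by rewrite mem_skew_cells // in_skew_col // ltnn andbF andbF.
move: rc e2; rewrite -bc /content; move: (rightmost_cell _ _ _ _) => [a b] /= e eb.
by rewrite eb in e *; congr (_, _); lia.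
Qed.

(** Columns before [col_first] or after [col_last] are empty. They form unitriangular diagonal
    blocks, and the entries below the blocks have negative degree, so only the middle block
    counts. *)
Lemma Sdet_cols :
  Sdet lam mu r af bf y z =
  (\det (\matrix_(i < ncols, j < ncols)
     jt_entry (col_bot_ord i) (col_top_ord j)))%R.
Proof.
have emp j : 0 < j -> ~~ (col_first <= j <= col_last) -> colLen lam j = colLen mu j.
  move=> j0 jc; apply: colLen_empty => // i; apply: contra jc => ics.
  have [cx _] := content_cmin r ok cs0 ics.
  by have [jx _] := cellat_indiag ok cs0 ics cx; apply: (indiag_cols ok conn cs0 jx).
have fl : col_first <= col_last.
  have i0 : 0 < ncols by [].
  by have := ord_col ok conn cs0 (Ordinal i0); lia.
have [f0 _] : 0 < col_first /\ _ := col_nonempty ok conn cs0 (introT andP (conj (leqnn _) fl)).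
have [l0 lc] : 0 < col_last /\ _ := col_nonempty ok conn cs0 (introT andP (conj fl (leqnn _))).
have ls : col_last <= size af.
  apply: leq_trans size_af; case: ok => pl _ _.
  by rewrite rowLen_colLen // (leq_ltn_trans _ lc).
set n := size af - col_last.
have e : size af = col_first.-1 + (ncols + n) by rewrite /n /ncols; lia.
have -> : Sdet lam mu r af bf y z = (\det (\matrix_(i < size af, j < size af) skew_entry i j))%R by [].
have -> : (\det (\matrix_(i < size af, j < size af) skew_entry i j) =
    \det (\matrix_(i < col_first.-1 + (ncols + n), j < col_first.-1 + (ncols + n))
      skew_entry i j))%R.
  by rewrite -e.
rewrite det_mx_ublock; last first.
  move=> a b /andP[ka _] bk; apply: skew_entry_lt; first exact: leq_trans ka.
  by rewrite -emp //; [apply: colLen_anti; lia | lia].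
rewrite (@det_mx_unitrig _ col_first.-1) ?mul1r; first last.
- move=> a b /andP[ba ak]; apply: skew_entry_lt => //.
  by rewrite -emp //; [apply: colLen_anti; lia | lia].
- by move=> a ak; apply: skew_entry_diag; apply: emp => //; lia.
pose f a b := skew_entry (col_first.-1 + a) (col_first.-1 + b).
rewrite (@det_mx_ublock _ _ _ f); last first.
  move=> a b /andP[ka _] bk; apply: skew_entry_lt; first lia.
  by rewrite emp //; [apply: colLen_anti; lia | move: ka; rewrite /ncols; lia].
rewrite (@det_mx_unitrig _ n (fun a b => f (ncols + a) (ncols + b))) ?mulr1; first last.
- move=> a b /andP[ba ak]; apply: skew_entry_lt; first lia.
  by rewrite emp //; [apply: colLen_anti; lia | rewrite /ncols; lia].
- by move=> a ak; apply: skew_entry_diag; apply: emp => //; rewrite /ncols; lia.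
congr (\det _)%R; apply/matrixP => i j; rewrite !mxE.
rewrite (col_bot_ordE ok conn cs0) (col_top_ordE ok conn cs0).
have ic := ord_col ok conn cs0 i; have jc := ord_col ok conn cs0 j.
rewrite /f /skew_entry /jt_entry /flag_a /flag_b leftmost_top // rightmost_bot //=.
have e1 (a : nat) : (col_first.-1 + a).+1 = col_first + a by lia.
rewrite !e1 /Defs.fl.
have [_ bc] := col_botP ok conn cs0 ic; have [_ tc] := col_topP ok conn cs0 jc.
have tc' : ct ((colLen mu (col_first + j)).+1, col_first + j) =
    (cmin + (col_top lam mu r (col_first + j))%:Z - 1)%R.
  by rewrite tc /col_top /=; lia.
rewrite -bc -tc' subrK; congr (esup _ _ _).
move: bc tc'; rewrite /content /=; lia.
Qed.

End JacobiTrudi.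

(** The empty and undefined cases are the diagonal and the strictly lower part of the unitriangular
    matrix [ribQ]; the remaining case is [det_ribQ] for the column bottoms of the sub-ribbon. *)
Lemma hash_entryE (R : comNzRingType) (lam mu : seq nat) (r : int)
    (af bf : seq int) (k : nat) (lab : cell -> 'I_k) (y z : int -> R) i j :
  skew_ok lam mu -> skew_cells lam mu != [::] -> outer_ribbon_decomp lam mu lab ->
  hash_entry lam mu r lab af bf y z i j =
  ribQ (right_steps lam mu r lab) (jt_entry lam mu r af bf y z) (ndiag lam mu r).+1
    (rib_start_ord lam mu r lab i) (rib_end_ord lam mu r lab j).
Proof.
move=> ok cs0 outer.
set T := jt_entry _ _ _ _ _ _ _; set X := right_steps _ _ _ _.
have T1 : forall x, T x x = 1%R by apply: jt_entry_diag.
have T0 : forall x w, w < x -> T x w = 0%R by apply: jt_entry_lt.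
have sE := rib_start_ordE r ok cs0 outer i; have eE := rib_end_ordE r ok cs0 outer j.
have [ps [_ /andP[_ sn]]] := rib_startP r ok cs0 outer i.
have [_ [pe /andP[_ en]]] := rib_startP r ok cs0 outer j.
set s := rib_start _ _ _ _ i in sE ps sn *; set e := rib_end _ _ _ _ j in eE pe en *.
set c := cmin lam mu r in ps pe.
rewrite /hash_entry ps pe.
have -> : (c + s%:Z == c + e%:Z - 1 + 1)%R = (s == e) by apply/eqP/eqP; lia.
have -> : (c + e%:Z - 1 + 1 < c + s%:Z)%R = (e < s) by apply/idP/idP; lia.
case: (ltngtP s e) => se; last 1 first.
- have -> : rib_end_ord lam mu r lab j = rib_start_ord lam mu r lab i.
    by apply: val_inj; rewrite /= sE eE.
  by rewrite ribQ_diag.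
- have -> : absz (c + e%:Z - 1 - (c + s%:Z) + 1)%R = e - s by lia.
  set u := dir_up lam mu r lab; set p := (c + s%:Z)%R; set L := e - s.
  have L0 : 0 < L by rewrite subn_gt0.
  rewrite Sdet_ribbon //; last by rewrite size_mkseq.
  set N := rib_cols u p L; pose b i := rib_bot_off u p L i.+1.
  (* The first [N + 1] values are the column bottoms followed by the end [e]. Beyond [N] the values
     only continue the sequence, because [det_ribQ] asks for a function increasing on all of
     [nat]. *)
  pose f i := if i <= N then s + b i else e + (i - N).
  have bN : b N = L by apply: rib_bot_off_last.
  have b_inc i1 i2 : i1 < i2 <= N -> b i1 < b i2 by apply: rib_bot_off_inc.
  have f_inc : {homo f : i1 i2 / i1 < i2}.
    move=> i1 i2 lt; rewrite /f; case: (leqP i2 N) => h2.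
      by rewrite (leq_trans (ltnW lt) h2) ltn_add2l b_inc // lt.
    case: (leqP i1 N) => h1; last lia.
    suff : b i1 <= b N by rewrite bN /L; lia.
    by move: h1; rewrite leq_eqVlt => /predU1P[->//|h1]; apply/ltnW/b_inc; rewrite h1 leqnn.
  have f0 : f 0 = s by rewrite /f /b rib_bot_off0 // addn0.
  have fN : f N = e by rewrite /f leqnn bN /L; lia.
  rewrite -(@det_ribQ _ X T T1 T0 _ N f) ?sE ?eE //.
  + congr (\det _)%R; apply/matrixP => a d; rewrite !mxE.
    have aN := ltn_ord a; have dN := ltn_ord d.
    have [td _ _ _] := rib_top_offP L0 dN.
    rewrite /f dN (ltnW aN) /b -td /ind_a /ind_b !nth_mkseq // /T /jt_entry /flag_a /flag_b -/c.
    set v := rib_bot_off _ _ _ _; set t := rib_top_off _ _ _ _.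
    have -> : (p + t%:Z = c + (s + t.+1)%:Z - 1)%R by rewrite /p; lia.
    have -> : (p + v%:Z = c + (s + v)%:Z)%R by rewrite /p; lia.
    by have -> : ((s + t.+1)%:Z - (s + v)%:Z = t.+1%:Z - v%:Z)%R by lia.
  + move=> a /andP[a0 aN].
    have := @rib_bot_off_right u p L L0 a; rewrite a0 aN => /(_ erefl) ua.
    have ba : b a < L by rewrite -bN b_inc // aN leqnn.
    have b0 : 0 < b a.
      have := @b_inc 0 a; rewrite a0 (ltnW aN) /b rib_bot_off0 //; exact.
    rewrite /X /right_steps /f (ltnW aN) -/c -/u.
    have -> : (c + (s + b a)%:Z - 1 = p + (b a)%:Z - 1)%R by rewrite /p; lia.
    by rewrite ua andbT; move: ba b0; rewrite /L; lia.
  move=> x /andP[sx xe]; rewrite /X /right_steps => /and3P[_ _ ux].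
  have [||a /andP[a0 aN] ba] := @rib_bot_off_surj u p L L0 (x - s).
  - by rewrite /L; lia.
  - apply/negbTE; move: ux; rewrite -/c -/u.
    by have -> : (c + x%:Z - 1 = p + (x - s)%:Z - 1)%R by rewrite /p; lia.
  by exists a; [rewrite a0 | rewrite /f (ltnW aN) /b ba; lia].
by rewrite ribQ_lt // sE eE.
Qed.

Theorem theorem5p13 (R : comNzRingType) (lam mu : seq nat) (r : int)
    (af bf : seq int) (k : nat) (lab : cell -> 'I_k) (y z : int -> R) :
  skew_ok lam mu ->
  edge_connected (skew_cells lam mu) ->
  strict_flags lam mu af bf ->
  outer_ribbon_decomp lam mu lab ->
  Sdet lam mu r af bf y z =
  (\det (\matrix_(i < k, j < k) hash_entry lam mu r lab af bf y z i j))%R.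
Proof.
move=> ok conn [[_ size_af _] _] outer.
have [cs0|cs0] := eqVneq (skew_cells lam mu) [::].
  (* For the empty shape both determinants are 1: ribbons are nonempty, so there are none and
     [k = 0]. *)
  rewrite Sdet_empty_cols; last by move=> j; apply: colLen_empty => // i; rewrite cs0.
  case: k lab outer => [|k] lab outer; first by rewrite det_mx00.
  by have [[]] := outer ord0; rewrite /ribbon_of cs0.
rewrite (Sdet_cols r bf y z ok conn cs0 size_af).
have -> : (\matrix_(i < k, j < k) hash_entry lam mu r lab af bf y z i j =
    \matrix_(i < k, j < k) ribQ (right_steps lam mu r lab) (jt_entry lam mu r af bf y z)
      (ndiag lam mu r).+1 (rib_start_ord lam mu r lab i) (rib_end_ord lam mu r lab j))%R.
  by apply/matrixP => i j; rewrite [LHS]mxE [RHS]mxE hash_entryE.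
apply: (linked_minor (diag_shape_skew r ok conn cs0) _ _ _ _
  (linked_ribbons r ok conn cs0 outer) (linked_cols r ok conn cs0)).
- exact: jt_entry_diag.
- exact: jt_entry_lt.
- by rewrite /right_steps.
- by rewrite /right_steps ltnn andbF.
Qed.
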